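(* Let $T>0$, $0<\alpha<1$, and let $p\in C[0,1]$ be real-valued with $p\le 0$ on $[0,1]$. Let $u\in H_\alpha(0,T;L^2(0,1))\cap L^2(0,T;H^2(0,1))$ satisfy $$\partial_t^\alpha u(x,t)=\partial_x^2u(x,t)+p(x)u(x,t),\quad 0<x<1,\ 0<t<T,$$ $$u(0,t)=\partial_xu(0,t)=0,\quad 0<t<T,$$ and suppose that $\partial_xu(1,\cdot)\in H_\alpha(0,T)$. Then $u(x,t)=0$ for $0<x<1$, $0<t<T$.
   Context: All functions are real-valued. For $0<\alpha<1$, $H^{\alpha}(0,T)$ is the fractional Sobolev space with norm $\|u\|_{H^\alpha(0,T)}=\big(\|u\|_{L^2(0,T)}^2+\int_0^T\int_0^T\frac{|u(t)-u(s)|^2}{|t-s|^{1+2\alpha}}\,dt\,ds\big)^{1/2}$. The space $H_\alpha(0,T)$ is defined by: $H_\alpha(0,T)=\{u\in H^\alpha(0,T): u(0)=0\}$ if $\frac12<\alpha<1$; $H_{1/2}(0,T)=\{v\in H^{1/2}(0,T): \int_0^T \frac{|v(t)|^2}{t}\,dt<\infty\}$; and $H_\alpha(0,T)=H^\alpha(0,T)$ if $0<\alpha<\frac12$. Its norm is that of $H^\alpha(0,T)$ for $\alpha\neq\frac12$, and $\big(\|v\|^2_{H^{1/2}(0,T)}+\int_0^T\frac{|v(t)|^2}{t}\,dt\big)^{1/2}$ for $\alpha=\frac12$. The space $H_\alpha(0,T;L^2(0,1))$ is the corresponding space of $L^2(0,1)$-valued functions. Let $J^\alpha g(t)=\frac{1}{\Gamma(\alpha)}\int_0^t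 (t-s)^{\alpha-1}g(s)\,ds$. It is known that $J^\alpha$ is an isomorphism from $L^2(0,T)$ onto $H_\alpha(0,T)$ (and likewise for $L^2(0,1)$-valued functions). Define $\partial_t^\alpha=(J^\alpha)^{-1}$ on $H_\alpha(0,T)$ (resp. on $H_\alpha(0,T;L^2(0,1))$); this extends the Caputo derivative of order $\alpha$. Boundary values at $x=0,1$ are understood in the sense of traces. *)

(* Defs.v *)
From HB Require Import structures.
From mathcomp Require Import all_boot all_order all_algebra.
From mathcomp Require Import all_classical all_reals all_analysis.
Import Order.TTheory GRing.Theory Num.Theory.
Import numFieldNormedType.Exports.

Set Implicit Arguments.
Unset Strict Implicit.
Unset Printing Implicit Defensive.

Local Open Scope classical_set_scope.
Local Open Scope ring_scope.

(* Elements of Lebesgue spaces are given by (Borel) representatives, and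
   equalities between them are almost-everywhere equalities.
   A function u of space x and time t is written [u x t]; it is also regarded
   as the (R -> R)-valued function of time [fun t => u^~ t]. *)

Notation leb := (@lebesgue_measure _) (only parsing).
Notation leb2 := (@lebesgue_measure _ \x @lebesgue_measure _)%E (only parsing).

Definition cyl {R : realType} (T : R) : set (R * R) := `]0, 1[ `*` `]0, T[.

Definition L2 d (X : measurableType d) (R : realType)
    (mu : {measure set X -> \bar R}) (D : set X) (f : X -> R) : Prop :=
  measurable_fun D f /\ mu.-integrable D (fun x => (f x ^+ 2)%:E).

Definition L2_01 {R : realType} : set (R -> R) := [set f | L2 leb `]0, 1[ f].

(* L^2(0,T; L^2(0,1)), identified with L^2((0,1) x (0,T)) *)
Definition L2cyl {R : realType} (T : R) (u : R -> R -> R) : Prop :=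
  L2 leb2 (cyl T) (fun z => u z.1 z.2).

Section fractional_sobolev.
Context {R : realType} (V : zmodType).
(* The value space is the set [X] of elements of [V], with squared norm [nsq];
   elements of [X] at squared distance 0 are identified. *)
Variables (X : set V) (nsq : V -> \bar R).
Local Open Scope ereal_scope.

Definition L2normsq (T : R) (v : R -> V) : \bar R :=
  \int[leb]_(t in `]0%R, T[) nsq (v t).

Definition seminormsq (a T : R) (v : R -> V) : \bar R :=
  \int[leb]_(t in `]0%R, T[) \int[leb]_(s in `]0%R, T[)
    (nsq (v t - v s)%R * ((`|t - s| `^ (1 + 2 * a))^-1)%R%:E).

(* v(0) = 0, evaluated on the representative of v continuous on [0,T]
   (which exists, and is unique, when v is in H^a(0,T) with a > 1/2) *)
Definition initial_value_zero (T : R) (v : R -> V) : Prop :=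
  exists w : R -> V,
    [/\ forall t, t \in `[0%R, T] -> X (w t),
        forall t0, t0 \in `[0%R, T] ->
          nsq (w t - w t0)%R @[t --> within `[0%R, T] (nbhs t0)] --> 0,
        \forall t \ae leb, t \in `]0%R, T[ -> nsq (v t - w t)%R = 0
      & nsq (w 0%R) = 0].

(* Measurability of v is not included here: see [H_scalar] and [H_L2]. *)
Definition H_cond (a T : R) (v : R -> V) : Prop :=
  [/\ L2normsq T v < +oo,
      seminormsq a T v < +oo,
      (2^-1 < a)%R -> initial_value_zero T v
    & a = 2^-1%R ->
      \int[leb]_(t in `]0%R, T[) (nsq (v t) * (t^-1)%R%:E) < +oo].

End fractional_sobolev.

(* H_a(0,T) *)
Definition H_scalar {R : realType} (a T : R) (g : R -> R) : Prop :=
  measurable_fun `]0, T[ g /\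
  H_cond [set: R] (fun r : R => (r ^+ 2)%:E) a T g.

(* H_a(0,T; L^2(0,1)) *)
Definition H_L2 {R : realType} (a T : R) (u : R -> R -> R) : Prop :=
  L2cyl T u /\
  H_cond L2_01 (fun f : R -> R => (\int[leb]_(x in `]0%R, 1%R[) (f x ^+ 2)%:E)%E)
    a T (fun t => u^~ t).

Definition Gamma {R : realType} (a : R) : R :=
  \int[leb]_(s in `]0, +oo[) (s `^ (a - 1) * expR (- s)).

Definition J {R : realType} (a : R) (g : R -> R) (t : R) : R :=
  (Gamma a)^-1 * \int[leb]_(s in `]0, t[) ((t - s) `^ (a - 1) * g s).

(* w is the fractional derivative (J^a)^{-1} u in L^2(0,T; L^2(0,1)) *)
Definition frac_deriv {R : realType} (a T : R) (u w : R -> R -> R) : Prop :=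
  L2cyl T w /\
  (fun z => J a (w z.1) z.2) = (fun z => u z.1 z.2) %[ae leb2 in cyl T].

Definition test_fun {R : realType} (phi : R -> R) : Prop :=
  (forall n x, derivable (phi^`(n))%classic x 1) /\
  exists c d : R, [/\ 0 < c, d < 1 & forall x, x \notin `[c, d] -> phi x = 0].

Definition weak_deriv {R : realType} (v w : R -> R) : Prop :=
  [/\ L2_01 v, L2_01 w & forall phi, test_fun phi ->
    \int[leb]_(x in `]0, 1[) (v x * (phi^`())%classic x) =
    - \int[leb]_(x in `]0, 1[) (w x * phi x)].

(* u is in L^2(0,T; H^2(0,1)), with first and second (weak) space
   derivatives ux and uxx *)
Definition L2H2 {R : realType} (T : R) (u ux uxx : R -> R -> R) : Prop :=
  [/\ L2cyl T u, L2cyl T ux, L2cyl T uxx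
    & \forall t \ae leb, t \in `]0, T[ ->
      weak_deriv (u^~ t) (ux^~ t) /\ weak_deriv (ux^~ t) (uxx^~ t)].

(* The trace of v in H^1(0,1) at x0 = 0 or 1 is c: its value at x0 is taken on
   the representative continuous on [0,1]. *)
Definition has_trace {R : realType} (v : R -> R) (x0 c : R) : Prop :=
  exists w : R -> R,
    [/\ {within `[0, 1], continuous w}, v = w %[ae leb in `]0, 1[%classic] & w x0 = c].

(* Main.v *)
Require Import Defs.
From HB Require Import structures.
From mathcomp Require Import all_boot all_order all_algebra.
From mathcomp Require Import all_classical all_reals all_analysis.
From mathcomp Require Import measurable_realfun ring lra.
Import Order.TTheory GRing.Theory Num.Theory.
Import numFieldNormedType.Exports.

Set Implicit Arguments.
Unset Strict Implicit.
Unset Printing Implicit Defensive.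

Local Open Scope classical_set_scope.
Local Open Scope ring_scope.

(** The equation is read as an evolution in [x] that starts from zero Cauchy data
    at [x = 0].  Weight the time variable by [expR (n * (T - t))] and let
    [hat n f x] be the integral over [0 < t < T] of the weighted [f x t].

    The fractional integral is a causal convolution with the kernel
    [r `^ (a - 1) / Gamma a].  On weighted integrals it acts as multiplication by
    a number that is at least [1 / (L * (n + 1))], up to an error coming from the
    truncation of the kernel at the final time.  That error stays bounded as [n]
    grows, because the weight is at most 1 where the kernel is cut
    ([fractional_laplace], [fractional_kernel_moment_ge]).  Inverting this
    multiplication turns the equation into the differential inequality in space
    [`|hat n uxx x| <= (L * (n + 1) + M) * `|hat n u x| + O(n)]
    ([slice_estimate]).

    The Cauchy data at [x = 0] say that [u] is the double primitive in [x] of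
    [uxx].  For almost every [t] this is a du Bois-Reymond argument
    ([weak_deriv_primitive]), and primitives in [x] commute with weighted
    integrals in [t] ([weighted_primitive]).  Hence Gronwall's inequality for
    double primitives applies and, for almost every [x], [hat n u x] is of order
    [n * expR (C * sqrt n)] ([double_primitive_gronwall]).

    This grows more slowly than [expR (e * n)] for every [e > 0].  But if [u x]
    is not almost everywhere zero then its weighted integrals grow
    exponentially, at a rate given by the distance from [T] to the start of the
    support.  Therefore [u x] is zero ([exp_moments_eq0]).  The equation has
    order two in space and order [a < 2] in time; this is why a power of [n]
    smaller than 1 appears in the exponent and why the argument closes. *)

(** * Smooth bump functions *)

Section bump_functions.
Context {R : realType}.
Implicit Types (P Q : {poly R}) (x y c d : R) (phi psi : R -> R).

(** Smoothness of all members of a class of functions follows from one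
    derivation, provided the class is closed under it. *)
Lemma derive_closed_smooth (S : (R -> R) -> Prop) :
  (forall phi, S phi -> (forall x, derivable phi x 1) /\ S phi^`()%classic) ->
  forall phi, S phi -> forall n x, derivable (phi^`(n))%classic x 1.
Proof.
move=> SP phi Sphi n; have : S (phi^`(n))%classic.
  by elim: n => // n IH; rewrite derive1nS; exact: (SP _ IH).2.
by move=> /SP[].
Qed.

(** The functions [P (1/x) * exp (-1/x)] extended by zero to [x <= 0].  Letting
    [P] vary makes the family closed under derivation. *)
Definition flat_exp P x : R := if 0 < x then P.[x^-1] * expR (- x^-1) else 0.

Lemma expR_exprn_bound n y : 0 <= y -> y ^+ n <= n`!%:R * expR y.
Proof.
move=> y0; case: n => [|n].
  by rewrite expr0 fact0 mul1r -expR0 ler_expR.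
have := expR_ge1Dxn n y0.
rewrite -(ler_pM2l (_ : 0 < n.+1`!%:R :> R)) ?ltr0n ?fact_gt0//.
by apply: le_trans; rewrite mulrDr mulr1 mulrCA divff ?mulr1 ?lerDr ?ler0n.
Qed.

(** [exp (-1/x)] beats every power of [1/x]. *)
Lemma flat_exp_bounded P : exists2 M : R, 0 <= M & forall x, `|flat_exp P x| <= M.
Proof.
exists (\sum_(i < size P) `|P`_i| * i`!%:R).
  by apply: sumr_ge0 => i _; rewrite mulr_ge0.
move=> x; rewrite /flat_exp; case: ifPn => [x0|_]; last first.
  by rewrite normr0; apply: sumr_ge0 => i _; rewrite mulr_ge0.
rewrite normrM [X in _ * X]ger0_norm ?expR_ge0// horner_coef.
apply: (le_trans (ler_wpM2r (expR_ge0 _) (ler_norm_sum _ _ _))).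
rewrite mulr_suml; apply: ler_sum => i _; rewrite normrM -mulrA.
rewrite ler_wpM2l// ger0_norm ?exprn_ge0 ?invr_ge0 ?(ltW x0)//.
rewrite expRN ler_pdivrMr ?expR_gt0//.
by apply: expR_exprn_bound; rewrite invr_ge0 ltW.
Qed.

Lemma is_derive_inv x : x != 0 -> is_derive x 1 (@GRing.inv R) (- x ^- 2).
Proof.
move=> x0; apply: DeriveDef.
  exact: (@derivableV _ _ id x 1 x0 (@derivable_id _ _ x 1)).
rewrite (@deriveV _ _ id x 1 x0 (@derivable_id _ _ x 1)) derive_id.
by rewrite /GRing.scale/= mulr1.
Qed.

(** Away from 0 this is the chain rule.  At 0, boundedness of the member with
    ['X^2 * P] in place of [P] shows that the function is [O(x^2)]. *)
Lemma is_derive_flat_exp P x :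
  is_derive x 1 (flat_exp P) (flat_exp ('X^2 * (P - P^`())) x).
Proof.
have [x0|x0|->] := ltgtP x 0.
- rewrite /flat_exp ifN -?leNgt ?ltW//.
  apply: (@near_eq_is_derive _ _ _ (cst 0)).
  near=> y; rewrite ifN// -leNgt ltW//.
  by near: y; exact: lt_nbhsl.
- apply: (@near_eq_is_derive _ _ _ ((horner P \o GRing.inv) *
      (expR \o (-%R \o GRing.inv)))).
    near=> y; rewrite /flat_exp ifT//.
    by near: y; exact: lt_nbhsr.
  have dinv := is_derive_inv (lt0r_neq0 x0).
  have dNinv : is_derive x 1 (-%R \o GRing.inv) (x ^- 2).
    apply: (is_derive_eq (is_deriveN dinv)); exact: opprK.
  have dP := @is_derive1_comp R (horner P) GRing.inv x _ _ (is_derive_poly P _) dinv.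
  have dE := @is_derive1_comp R expR (-%R \o GRing.inv) x _ _ (is_derive_expR _) dNinv.
  apply: (is_derive_eq (is_deriveM dP dE)).
  rewrite /flat_exp x0 /= !hornerE exprVn /GRing.scale/=; ring.
- have [M M0 bM] := flat_exp_bounded ('X^2 * P).
  have F0 Q : flat_exp Q 0 = 0 by rewrite /flat_exp ltxx.
  have FM y : `|flat_exp P y| <= M * y ^+ 2.
    have [y0|y0] := ltP 0 y; last first.
      by rewrite /flat_exp ltNge y0/= normr0 mulr_ge0// sqr_ge0.
    have -> : flat_exp P y = y ^+ 2 * flat_exp ('X^2 * P) y.
      by rewrite /flat_exp y0 /= hornerM hornerXn exprVn !mulrA divff ?mul1r ?sqrf_eq0 ?gt_eqF//.
    by rewrite normrM ger0_norm ?sqr_ge0// mulrC ler_wpM2r// sqr_ge0.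
  have cv : h^-1 *: ((flat_exp P \o shift 0) (h *: 1) - flat_exp P 0)
      @[h --> 0^'] --> (0 : R).
    apply/cvgr0Pnorm_le => e e0; near=> h.
    rewrite /= addr0 F0 subr0 /GRing.scale/= mulr1 normrM normfV.
    have h0 : h != 0 by near: h; exact: nbhs_dnbhs_neq.
    rewrite mulrC ler_pdivrMr ?normr_gt0//.
    apply: (le_trans (FM h)); rewrite -[h ^+ 2]ger0_norm ?sqr_ge0// normrX.
    rewrite expr2 mulrA ler_wpM2r//.
    rewrite (le_trans (_ : _ <= (M + 1) * `|h|))//; first by rewrite ler_wpM2r// lerDl.
    rewrite mulrC -ler_pdivlMr ?ltr_wpDl//.
    by near: h; apply: dnbhs0_le; rewrite divr_gt0// ltr_wpDl.
  rewrite F0; apply: DeriveDef; first by apply/cvg_ex; exists 0.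
  exact/cvg_lim.
Unshelve. all: by end_near. Qed.

(** The algebra generated by the functions flat to the left of some [c] or to
    the right of some [d]; it contains the bump functions and the combinations
    of them used as derivatives of test functions, and is closed under
    derivation. *)
Inductive bump_algebra : (R -> R) -> Prop :=
| bump_left P c : bump_algebra (flat_exp P \o (fun x => x - c))
| bump_right P d : bump_algebra (flat_exp P \o (fun x => d - x))
| bump_scale k phi : bump_algebra phi -> bump_algebra (k *: phi)
| bump_add phi psi :
    bump_algebra phi -> bump_algebra psi -> bump_algebra (phi + psi)
| bump_mul phi psi :
    bump_algebra phi -> bump_algebra psi -> bump_algebra (phi * psi).

Lemma bump_algebra_derive phi : bump_algebra phi ->
  exists2 dphi, bump_algebra dphi & forall x, is_derive x 1 phi (dphi x).
Proof.
elim=> {phi} [P c|P d|k phi _ [dphi Sd H]|phi psi S1 [d1 D1 H1] S2 [d2 D2 H2]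
  |phi psi S1 [d1 D1 H1] S2 [d2 D2 H2]].
- exists (flat_exp ('X^2 * (P - P^`())) \o (fun x => x - c)); first exact: bump_left.
  move=> x; have dl : is_derive x 1 (fun y => y - c) 1.
    by apply: (is_derive_eq (is_deriveB (is_derive_id x 1) (is_derive_cst c x 1))); rewrite subr0.
  apply: (is_derive_eq (is_derive1_comp (is_derive_flat_exp P _) dl)).
  by rewrite mulr1.
- exists ((-1) *: (flat_exp ('X^2 * (P - P^`())) \o (fun x => d - x))).
    exact/bump_scale/bump_right.
  move=> x; have dl : is_derive x 1 (fun y => d - y) (-1).
    by apply: (is_derive_eq (is_deriveB (is_derive_cst d x 1) (is_derive_id x 1))); rewrite sub0r.
  apply: (is_derive_eq (is_derive1_comp (is_derive_flat_exp P _) dl)).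
  by rewrite mulrC.
- exists (k *: dphi); first exact: bump_scale.
  by move=> x; have := H x; exact: is_deriveZ.
- exists (d1 + d2); first exact: bump_add.
  by move=> x; exact: is_deriveD (H1 x) (H2 x).
- exists (phi * d2 + psi * d1); first by apply: bump_add; exact: bump_mul.
  by move=> x; exact: is_deriveM (H1 x) (H2 x).
Qed.

Lemma bump_algebra_smooth phi : bump_algebra phi ->
  forall n x, derivable (phi^`(n))%classic x 1.
Proof.
apply: derive_closed_smooth => {}phi /bump_algebra_derive[dphi Sd H].
split=> [x|]; first by case: (H x).
suff -> : (phi^`())%classic = dphi by [].
by apply/funext => x; rewrite derive1E; case: (H x).
Qed.

Definition bump c d : R -> R :=
  (flat_exp 1 \o (fun x => x - c)) * (flat_exp 1 \o (fun x => d - x)).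

Lemma bump_in_algebra c d : bump_algebra (bump c d).
Proof. by apply: bump_mul; [exact: bump_left|exact: bump_right]. Qed.

Lemma bump_gt0 c d x : c < x < d -> 0 < bump c d x.
Proof.
move=> /andP[cx xd]; rewrite /bump mulrfctE/= /flat_exp !subr_gt0 cx xd.
by rewrite -polyC1 !hornerC !mul1r mulr_gt0 ?expR_gt0.
Qed.

Lemma bump_out c d x : ~~ (c < x < d) -> bump c d x = 0.
Proof.
rewrite /bump mulrfctE/= /flat_exp !subr_gt0.
by case: (c < x); case: (x < d); rewrite //= ?(mul0r, mulr0).
Qed.

Lemma bump_ge0 c d x : 0 <= bump c d x.
Proof.
by have [/bump_gt0/ltW//|/bump_out->] := boolP (c < x < d).
Qed.

End bump_functions.

(** * Integration over rectangles *)

Section almost_everywhere.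
Context d (T : measurableType d) (R : realType) (mu : {measure set T -> \bar R}).
Implicit Types P Q S : T -> Prop.

Lemma ae_imp P Q : (forall x, P x -> Q x) ->
  (\forall x \ae mu, P x) -> \forall x \ae mu, Q x.
Proof. exact: filterS. Qed.

Lemma ae_imp2 P Q S : (forall x, P x -> Q x -> S x) ->
  (\forall x \ae mu, P x) -> (\forall x \ae mu, Q x) ->
  \forall x \ae mu, S x.
Proof. exact: filterS2. Qed.

End almost_everywhere.

Section rectangle_fubini.
Context d1 d2 (T1 : measurableType d1) (T2 : measurableType d2) (R : realType).
Variable m1 : {sigma_finite_measure set T1 -> \bar R}.
Variable m2 : {sigma_finite_measure set T2 -> \bar R}.
Variables (A : set T1) (B : set T2).
Hypotheses (mA : measurable A) (mB : measurable B).
Implicit Type f : T1 -> T2 -> R.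

Let patch_rect f x y :
  ((fun z => (f z.1 z.2)%:E) \_ (A `*` B)) (x, y) =
  ((fun x => ((EFin \o f x) \_ B) y) \_ A) x :> \bar R.
Proof.
rewrite !patchE in_setX/=.
by case: (x \in A); case: (y \in B).
Qed.

(** Tonelli's criterion on a rectangle. *)
Lemma integrable_rectP f : measurable_fun (A `*` B) (fun z => f z.1 z.2) ->
  (\int[m1]_(x in A) \int[m2]_(y in B) `|f x y|%:E < +oo)%E ->
  (m1 \x m2)%E.-integrable (A `*` B) (fun z => (f z.1 z.2)%:E).
Proof.
move=> mf foo; have mAB := measurableX mA mB.
apply/(integrable_mkcond _ mAB)/integrable12ltyP.
  by apply/(measurable_restrictT _ mAB); exact/measurable_EFinP.
apply: le_lt_trans foo.
rewrite [leRHS]integral_mkcond; rewrite le_eqVlt; apply/orP; left; apply/eqP/eq_integral => x _.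
rewrite patchE; under eq_integral do rewrite patch_rect patchE.
case: ifPn => xA; last by rewrite integral0_eq// => y _; rewrite abse0.
rewrite [RHS]integral_mkcond; apply: eq_integral => y _.
by rewrite !patchE; case: ifPn => //; rewrite abse0.
Qed.

Lemma measurable_rect_integral f :
  measurable_fun (A `*` B) (fun z => f z.1 z.2) ->
  measurable_fun A (fun x => \int[m2]_(y in B) `|f x y|%:E)%E.
Proof.
move=> mf; have mAB := measurableX mA mB.
have mg : measurable_fun setT ((fun z => (f z.1 z.2)%:E) \_ (A `*` B)).
  by apply/(measurable_restrictT _ mAB); exact/measurable_EFinP.
have mF := measurable_fun_fubini_tonelli_F (m2 := m2) _
  (measurableT_comp (@abse_measurable R setT) mg) (fun z => abse_ge0 _).
apply: (eq_measurable_fun _ _ (measurable_funTS mF)) => x /[!inE] Ax.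
rewrite /fubini_F [RHS]integral_mkcond; apply: eq_integral => y _ /=.
rewrite patch_rect patchE mem_set// !patchE.
by case: ifPn => // _; rewrite abse0.
Qed.

Section fixed_integrand.
Variable f : T1 -> T2 -> R.
Hypothesis intf :
  (m1 \x m2)%E.-integrable (A `*` B) (fun z => (f z.1 z.2)%:E).

Let g := ((fun z => (f z.1 z.2)%:E) \_ (A `*` B)) : T1 * T2 -> \bar R.

Let intg : (m1 \x m2)%E.-integrable setT g.
Proof. exact/(integrable_mkcond _ (measurableX mA mB)). Qed.

Let int_g x : A x -> (\int[m2]_y g (x, y) = \int[m2]_(y in B) (f x y)%:E)%E.
Proof.
move=> Ax; rewrite [RHS]integral_mkcond; apply: eq_integral => y _.
by rewrite /g patch_rect patchE mem_set.
Qed.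

Lemma rect_ae_integrable :
  \forall x \ae m1, A x -> m2.-integrable B (EFin \o f x).
Proof.
have := ae_integrable1 intg; apply: filterS => x + Ax.
move=> h; apply/(integrable_mkcond _ mB); apply: eq_integrable h => // y _.
by rewrite /g patch_rect patchE mem_set.
Qed.

Let ae_int_fin : \forall x \ae m1, A x ->
  (\int[m2]_y g (x, y))%E = (\int[m2]_(y in B) f x y)%:E.
Proof.
apply: filterS rect_ae_integrable => x + Ax => /(_ Ax) fx.
by rewrite int_g// /Rintegral fineK//; exact: integrable_fin_num.
Qed.

Lemma rect_integrable_Rintegral :
  m1.-integrable A (EFin \o (fun x => \int[m2]_(y in B) f x y)).
Proof.
have iF : m1.-integrable A (fun x => \int[m2]_y g (x, y))%E.
  by apply: integrableS (integrable_fubini_F intg).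
apply: (le_integrable mA _ _ iF).
- apply/measurable_EFinP.
  apply: (eq_measurable_fun (fine \o (fun x => \int[m2]_y g (x, y))%E)).
    by move=> x /[!inE] Ax /=; rewrite int_g.
  by apply: measurableT_comp => //; exact: measurable_int iF.
- move=> x Ax /=; rewrite int_g// /Rintegral.
  by case: (\int[m2]_(y in B) _)%E => //=; rewrite normr0 leey.
Qed.

(** The inner real integrals may be meaningless on a null set of [x], where
    they take a default value; this does not affect the outer integral. *)
Lemma rect_fubini1 :
  \int[m1]_(x in A) (\int[m2]_(y in B) f x y) =
  Rintegral (m1 \x m2)%E (A `*` B) (fun z => f z.1 z.2).
Proof.
rewrite /Rintegral; congr fine.
rewrite [RHS]integral_mkcond -/g -(integral12_prod_meas1 intg).
rewrite /fubini_F integral_mkcond.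
have gA x : ~ A x -> (\int[m2]_y g (x, y) = 0)%E.
  move=> nAx; rewrite integral0_eq// => y _.
  by rewrite /g patch_rect patchE memNset.
rewrite [RHS](_ : _ = \int[m1]_(x in A) \int[m2]_y g (x, y))%E; last first.
  rewrite [RHS]integral_mkcond; apply: eq_integral => x _; rewrite patchE.
  by case: ifPn => //; rewrite notin_setE => /gA.
rewrite -integral_mkcond; apply: ae_eq_integral => //.
- by have /integrableP[] := rect_integrable_Rintegral.
- by have /integrableP[m _] := integrable_fubini_F intg; exact: measurable_funTS.
- by apply: filterS ae_int_fin => x + Ax => /(_ Ax) ->.
Qed.

End fixed_integrand.
End rectangle_fubini.

Section rectangle_fubini_swap.
Context d1 d2 (T1 : measurableType d1) (T2 : measurableType d2) (R : realType).
Variable m1 : {sigma_finite_measure set T1 -> \bar R}.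
Variable m2 : {sigma_finite_measure set T2 -> \bar R}.
Variables (A : set T1) (B : set T2).
Hypotheses (mA : measurable A) (mB : measurable B).
Variable f : T1 -> T2 -> R.
Hypothesis intf :
  (m1 \x m2)%E.-integrable (A `*` B) (fun z => (f z.1 z.2)%:E).

Let g := ((fun z => (f z.1 z.2)%:E) \_ (A `*` B)) : T1 * T2 -> \bar R.

Let intg : (m1 \x m2)%E.-integrable setT g.
Proof. exact/(integrable_mkcond _ (measurableX mA mB)). Qed.

Let g' (z : T2 * T1) := g (z.2, z.1).

Let g'E : g' = (fun z => (f z.2 z.1)%:E) \_ (B `*` A).
Proof.
apply/funext => -[y x]; rewrite /g' /g !patchE !in_setX/=.
by case: (x \in A); case: (y \in B).
Qed.

Let intg' : (m2 \x m1)%E.-integrable setT g'.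
Proof.
have mg : measurable_fun setT g by exact: measurable_int intg.
apply/integrable12ltyP; last exact/(integrable21ltyP _ _ mg).
by apply: measurableT_comp => //; exact: measurable_swap.
Qed.

Lemma rect_integrable_swap :
  (m2 \x m1)%E.-integrable (B `*` A) (fun z => (f z.2 z.1)%:E).
Proof. by apply/(integrable_mkcond _ (measurableX mB mA)); rewrite -g'E. Qed.

Lemma rect_fubini :
  \int[m1]_(x in A) (\int[m2]_(y in B) f x y) =
  \int[m2]_(y in B) (\int[m1]_(x in A) f x y).
Proof.
rewrite (rect_fubini1 mA mB intf).
rewrite (@rect_fubini1 _ _ _ _ _ _ _ _ _ mB mA (fun y x => f x y) rect_integrable_swap).
rewrite /Rintegral integral_mkcond [in RHS]integral_mkcond -/g.
have <- : g' = (fun z => (f z.2 z.1)%:E) \_ (B `*` A) by [].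
by rewrite -(integral12_prod_meas1 intg') -(integral21_prod_meas1 intg).
Qed.

End rectangle_fubini_swap.

Section integrable_products.
Context d (T : measurableType d) (R : realType).

Lemma integrable_mul_bounded (mu : {measure set T -> \bar R}) (D : set T)
    (k f : T -> R) (M : R) : measurable D -> measurable_fun D k ->
  (forall x, D x -> `|k x| <= M) -> mu.-integrable D (EFin \o f) ->
  mu.-integrable D (EFin \o (fun x => k x * f x)).
Proof.
move=> mD mk kM intf.
have := integrableMr mD mk _ intf; apply.
exists M; split; first exact: num_real.
by move=> y /ltW My x /= Dx; rewrite (le_trans (kM _ Dx)).
Qed.

Lemma integrable_scale (mu : {measure set T -> \bar R}) (D : set T) (k : R)
    (f : T -> R) : measurable D -> mu.-integrable D (EFin \o f) ->
  mu.-integrable D (EFin \o (fun x => k * f x)).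
Proof. by move=> mD; apply: (integrable_mul_bounded (M := `|k|)). Qed.

Lemma measurable_bool_natr (D : set T) (b : T -> bool) :
  measurable_fun D b -> measurable_fun D (fun x => (b x)%:R : R).
Proof.
by move=> mb; apply: (measurableT_comp (f := fun b : bool => b%:R : R)).
Qed.

Lemma integrable_mul_bool (mu : {measure set T -> \bar R}) (D : set T)
    (b : T -> bool) (f : T -> R) : measurable D -> measurable_fun D b ->
  mu.-integrable D (EFin \o f) ->
  mu.-integrable D (EFin \o (fun x => (b x)%:R * f x)).
Proof.
move=> mD mb; apply: (integrable_mul_bounded (M := 1)) => //.
  exact: measurable_bool_natr.
by move=> x _; rewrite normr_nat lern1; case: (b x).
Qed.

(** [`|y| <= 1 + y ^+ 2], so that square integrability on a set of finite
    measure implies integrability. *)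
Lemma L2_integrable (mu : {measure set T -> \bar R}) (D : set T)
    (f : T -> R) : measurable D -> (mu D < +oo)%E -> L2 mu D f ->
  mu.-integrable D (EFin \o f).
Proof.
move=> mD Doo [mf intf2].
apply: (le_integrable mD (g := fun x => (1 + f x ^+ 2)%:E)).
- exact/measurable_EFinP.
- move=> x Dx /=; rewrite lee_fin [leRHS]ger0_norm ?addr_ge0 ?sqr_ge0//.
  rewrite -(real_normK (num_real (f x))).
  have [f1|/ltW f1] := leP `|f x| 1; first by rewrite (le_trans f1)// lerDl sqr_ge0.
  by rewrite -[leLHS]add0r lerD// -[leLHS]mul1r expr2 ler_wpM2r.
- under [X in _.-integrable _ X]eq_fun do rewrite EFinD.
  apply: integrableD => //.
  apply/integrableP; split; first exact: measurable_cst.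
  by under eq_integral do rewrite /= normr1; rewrite integral_cst// mul1e.
Qed.

Lemma ae_eq_Rintegral (mu : {measure set T -> \bar R}) (D : set T)
    (f g : T -> R) : measurable D ->
  mu.-integrable D (EFin \o f) -> measurable_fun D g ->
  (\forall x \ae mu, D x -> f x = g x) ->
  \int[mu]_(x in D) f x = \int[mu]_(x in D) g x.
Proof.
move=> mD intf mg fg; congr fine; apply: ae_eq_integral => //.
- exact: measurable_int intf.
- exact/measurable_EFinP.
- by apply: ae_imp fg => x fg /fg /= ->.
Qed.

End integrable_products.

Lemma integrable_kernel d1 d2 (T1 : measurableType d1) (T2 : measurableType d2)
    (R : realType) (m1 : {sigma_finite_measure set T1 -> \bar R})
    (m2 : {sigma_finite_measure set T2 -> \bar R}) (A : set T1) (B : set T2)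
    (k : T1 -> T2 -> R) (h : T2 -> R) (M : R) :
  measurable A -> measurable B -> (m1 A < +oo)%E ->
  measurable_fun (A `*` B) (fun z => k z.1 z.2) ->
  (forall x y, A x -> B y -> `|k x y| <= M) ->
  m2.-integrable B (EFin \o h) ->
  (m1 \x m2)%E.-integrable (A `*` B) (fun z => (k z.1 z.2 * h z.2)%:E).
Proof.
move=> mA mB Aoo mk kM inth; have mAB := measurableX mA mB.
apply: (@integrable_mul_bounded _ _ _ (m1 \x m2)%E _ (fun z => k z.1 z.2)
  (h \o snd) M) => //.
  by move=> [x y] [Ax By]; exact: kM.
have /integrableP[/measurable_EFinP mh hoo] := inth.
apply: (integrable_rectP mA mB (f := fun x y => h y)) => //=.
  apply: (measurable_comp mB _ mh).
    by move=> _ [[x y] [_ By] <-].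
  exact: measurable_funTS measurable_snd.
rewrite integral_cst//.
rewrite muleC lte_mul_pinfty// ge0_fin_numE// integral_ge0//.
Qed.

(** * Primitives and integration over a triangle *)

Section triangle.
Context {R : realType}.
Notation mu := (@lebesgue_measure R).
Implicit Types (a b x y M : R) (f g w : R -> R).

(** Turns a variable endpoint into a kernel on a fixed interval, the form in
    which Fubini's theorem applies. *)
Lemma Rintegral_below a b w x : x <= b ->
  \int[mu]_(y in `]a, x[) w y = \int[mu]_(y in `]a, b[) ((y < x)%R%:R * w y).
Proof.
move=> xb; rewrite Rintegral_mkcond [RHS]Rintegral_mkcond.
apply: eq_Rintegral => y _; rewrite !patchE !mem_setE !in_itv/=.
have [yx|yx] := ltP y x; rewrite ?(andbT, andbF)/=.
  by rewrite (lt_le_trans yx xb) andbT mul1r.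
by rewrite mul0r if_same.
Qed.

Lemma Rintegral_above a b w y : a <= y ->
  \int[mu]_(x in `]y, b[) w x = \int[mu]_(x in `]a, b[) ((y < x)%R%:R * w x).
Proof.
move=> ay; rewrite Rintegral_mkcond [RHS]Rintegral_mkcond.
apply: eq_Rintegral => x _; rewrite !patchE !mem_setE !in_itv/=.
have [yx|yx] := ltP y x; rewrite ?(andbT, andbF)/=.
  by rewrite (le_lt_trans ay yx) mul1r.
by rewrite mul0r if_same.
Qed.

Lemma measurable_lt_kernel (D : set (R * R)) :
  measurable_fun D (fun z : R * R => (z.2 < z.1)%R%:R : R).
Proof.
apply: measurable_funTS.
apply: measurable_bool_natr; apply: measurable_fun_ltr.
  exact: measurable_snd.
exact: measurable_fst.
Qed.

Lemma lebesgue_oo_lty a b : (mu `]a, b[ < +oo)%E.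
Proof. by rewrite lebesgue_measure_itv/=; case: ifP; rewrite ltry. Qed.

Lemma integrable_triangle a b g w M :
  measurable_fun `]a, b[ g -> (forall x, x \in `]a, b[ -> `|g x| <= M) ->
  mu.-integrable `]a, b[ (EFin \o w) ->
  (mu \x mu)%E.-integrable (`]a, b[ `*` `]a, b[)
    (fun z => ((g z.1 * (z.2 < z.1)%R%:R) * w z.2)%:E).
Proof.
move=> mg gM intw.
apply: (@integrable_kernel _ _ _ _ _ mu mu _ _
  (fun x y => g x * (y < x)%R%:R) w M) => //.
- exact: lebesgue_oo_lty.
- apply: measurable_funM; last exact: measurable_lt_kernel.
  apply: (measurable_comp (F := `]a, b[%classic) _ _ mg) => //.
    by move=> _ [[x y] [/= Ax _] <-].
  exact: measurable_funTS measurable_fst.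
- move=> x y Ax _; rewrite normrM (le_trans _ (gM _ Ax))//.
  by rewrite ler_piMr// normr_nat lern1; case: (_ < _).
Qed.

(** Fubini's theorem on the triangle [a < y < x < b]. *)
Lemma triangle_fubini a b g w M :
  measurable_fun `]a, b[ g -> (forall x, x \in `]a, b[ -> `|g x| <= M) ->
  mu.-integrable `]a, b[ (EFin \o w) ->
  \int[mu]_(x in `]a, b[) (g x * \int[mu]_(y in `]a, x[) w y) =
  \int[mu]_(y in `]a, b[) ((\int[mu]_(x in `]y, b[) g x) * w y).
Proof.
move=> mg gM intw; have intK := integrable_triangle mg gM intw.
transitivity (\int[mu]_(x in `]a, b[) \int[mu]_(y in `]a, b[)
    ((g x * (y < x)%R%:R) * w y)).
  apply: eq_Rintegral => x; rewrite inE/= in_itv/= => /andP[ax xb].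
  rewrite (Rintegral_below _ _ (ltW xb)) -RintegralZl//.
    by apply: eq_Rintegral => y _; rewrite mulrA.
  by apply: integrable_mul_bool => //; exact: measurable_fun_ltr.
rewrite (rect_fubini _ _ intK)//.
apply: eq_Rintegral => y; rewrite inE/= in_itv/= => /andP[ay yb].
rewrite (Rintegral_above _ _ (ltW ay)) -RintegralZr//.
  by apply: eq_Rintegral => x _; rewrite (mulrC (g x)).
have intg : mu.-integrable `]a, b[ (EFin \o g).
  apply: measurable_bounded_integrable => //; first exact: lebesgue_oo_lty.
  exists M; split; first exact: num_real.
  by move=> z /ltW Mz x /= Ax; rewrite (le_trans (gM _ Ax)).
by apply: integrable_mul_bool => //; exact: measurable_fun_ltr.
Qed.

Lemma primitive_integrable a b w : mu.-integrable `]a, b[ (EFin \o w) ->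
  mu.-integrable `]a, b[ (EFin \o (fun x => \int[mu]_(y in `]a, x[) w y)).
Proof.
move=> intw.
have int1 : (mu \x mu)%E.-integrable (`]a, b[ `*` `]a, b[)
    (fun z => ((1 * (z.2 < z.1)%R%:R) * w z.2)%:E).
  by apply: (integrable_triangle (g := fun=> 1) (M := 1)) => // x _; rewrite normr1.
have := @rect_integrable_Rintegral _ _ _ _ R mu mu _ _ (measurable_itv _)
  (measurable_itv _) (fun x y => (1 * (y < x)%R%:R) * w y) int1.
apply: eq_integrable => // x.
rewrite inE/= in_itv/= => /andP[ax xb]/=; rewrite (Rintegral_below _ _ (ltW xb)).
by congr EFin; apply: eq_Rintegral => y _; rewrite mul1r.
Qed.

End triangle.

(** * The du Bois-Reymond lemma *)

Section du_bois_reymond.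
Context {R : realType}.
Notation mu := (@lebesgue_measure R).
Implicit Types (c d x : R) (phi theta D v w : R -> R).

Lemma within_continuous_bounded (a b : R) (f : R -> R) : a <= b ->
  {within `[a, b], continuous f} ->
  exists M : R, forall x, x \in `[a, b] -> `|f x| <= M.
Proof.
move=> ab cf; have cnf : {within `[a, b], continuous (fun x => `|f x|)}.
  by move=> x; apply: continuous_comp; [exact: cf|exact: norm_continuous].
by have [z _ zM] := EVT_max ab cnf; exists `|f z|.
Qed.

Lemma continuous_bounded_measurable_oo (f : R -> R) :
  {within `[0, 1], continuous f} ->
  measurable_fun (`]0, 1[ : set R) f /\
  exists M : R, forall x, x \in `]0, 1[ -> `|f x| <= M.
Proof.
move=> cf; split.
  have : measurable_fun (`[0, 1] : set R) f by exact: subspace_continuous_measurable_fun.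
  by apply: measurable_funS => //; exact: subset_itv_oo_cc.
have [M fM] := within_continuous_bounded ler01 cf.
by exists M => x x01; apply: fM; exact: subset_itv_oo_cc.
Qed.

Lemma continuous_integrable_oo (f : R -> R) :
  {within `[0, 1], continuous f} -> mu.-integrable `]0, 1[ (EFin \o f).
Proof.
move=> cf; have : mu.-integrable `[0, 1] (EFin \o f).
  by apply: continuous_compact_integrable => //; exact: segment_compact.
by apply: integrableS => //; exact: subset_itv_oo_cc.
Qed.

Lemma derivable_continuous f : (forall x, derivable f x 1) -> continuous (f : R -> R).
Proof.
by move=> df x; exact/differentiable_continuous/derivable1_diffP/df.
Qed.

Lemma bump_algebra_continuous phi : bump_algebra phi -> continuous phi.
Proof. by move=> /bump_algebra_smooth s; exact/derivable_continuous/(s 0%N). Qed.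

(** The primitive from minus infinity vanishes on the left of the support, and
    on the right because the total integral is zero. *)
Lemma bump_algebra_primitive_test theta c d :
  0 < c -> c < d -> d < 1 -> bump_algebra theta ->
  (forall x, x \notin `[c, d] -> theta x = 0) ->
  \int[mu]_(x in `]0, 1[) theta x = 0 ->
  exists2 phi, test_fun phi & (phi^`())%classic = theta.
Proof.
move=> c0 cd d1 Atheta out mean0.
have ctheta := bump_algebra_continuous Atheta.
have intT : mu.-integrable setT (EFin \o theta).
  have intcd : mu.-integrable `[c, d] (EFin \o theta).
    apply: continuous_compact_integrable; first exact: segment_compact.
    exact: continuous_subspaceT.
  have := (@integrable_mkcond _ _ R mu `[c, d] (EFin \o theta) (measurable_itv _)).1 intcd.
  apply: eq_integrable => // x _; rewrite patchE.
  by case: ifPn => //=; rewrite mem_setE => /out ->.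
pose phi x := \int[mu]_(t in `]-oo, x]) theta t.
have phiP x : derivable phi x 1 /\ (phi^`())%classic x = theta x.
  apply: (@continuous_FTC1 _ theta -oo%O x (x + 1)) => //.
  - by rewrite ltrDl.
  - exact: integrableS intT.
  - exact: ltNyr.
  - exact: ctheta.
have phi' : (phi^`())%classic = theta by apply/funext => x; exact: (phiP x).2.
exists phi => //; split.
  case=> [x|n x]; first exact: (phiP x).1.
  by rewrite derive1Sn phi'; exact: bump_algebra_smooth.
exists c, d; split => // x; rewrite in_itv/= negb_and -!ltNge => /orP[xc|dx].
- rewrite /phi /Rintegral integral0_eq// => t /=; rewrite in_itv/= => tx.
  by rewrite out// in_itv/= negb_and -ltNge (le_lt_trans tx xc).
- rewrite /phi Rintegral_mkcond -[RHS]mean0 [RHS]Rintegral_mkcond.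
  apply: eq_Rintegral => t _; rewrite !patchE !mem_setE !in_itv/=.
  have [tcd|/out ->] := boolP (t \in `[c, d]); last by rewrite !if_same.
  move: tcd; rewrite in_itv/= => /andP[ct td].
  by rewrite (le_trans td (ltW dx)) (lt_le_trans c0 ct) (le_lt_trans td d1).
Qed.

Lemma bump_integral_gt0 c d : 0 < c -> c < d -> d < 1 ->
  0 < \int[mu]_(x in `]0, 1[) bump c d x.
Proof.
move=> c0 cd d1; rewrite lt_neqAle Rintegral_ge0 ?andbT; last first.
  by move=> x _; exact: bump_ge0.
apply/negP => /eqP/esym int0.
have intb : mu.-integrable `]0, 1[ (EFin \o bump c d).
  apply: continuous_integrable_oo; apply: continuous_subspaceT.
  exact/bump_algebra_continuous/bump_in_algebra.
have : (\int[mu]_(x in `]0%R, 1%R[) `|(EFin \o bump c d) x|)%E = 0%E.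
  under eq_integral do rewrite gee0_abs ?lee_fin ?bump_ge0//.
  by rewrite -[LHS]fineK ?integrable_fin_num// [fine _]int0.
move/((@ae_eq_integral_abs _ _ R mu _ (measurable_itv `]0, 1[) (EFin \o bump c d)
  (measurable_int _ intb)).1).
case=> N [mN N0 subN].
have cdN : `]c, d[ `<=` N.
  move=> x; rewrite /= in_itv/= => /andP[cx xd]; apply: subN => /= h.
  have /h : x \in `]0, 1[.
    by rewrite in_itv/= (lt_trans c0 cx) (lt_trans xd d1).
  by move=> [] /eqP; rewrite gt_eqF// bump_gt0// cx xd.
have : (mu `]c, d[ <= mu N)%E.
  by apply: (le_measure mu _ _ cdN); rewrite inE.
by rewrite N0 lebesgue_measure_itv/= lte_fin cd -EFinB lee_fin leNgt subr_gt0 cd.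
Qed.

(** Subtracting a multiple of a fixed bump gives a bump of mean zero, hence the
    derivative of a test function.  So there is a [k], independent of the bump,
    such that [D - k] is orthogonal to every bump; a continuous function that is
    nonzero somewhere keeps its sign nearby and is not orthogonal to a bump
    supported there. *)
Lemma du_bois_reymond_continuous D : {within `[0, 1], continuous D} ->
  (forall phi, test_fun phi ->
    \int[mu]_(x in `]0, 1[) (D x * (phi^`())%classic x) = 0) ->
  exists k, forall x, x \in `]0, 1[ -> D x = k.
Proof.
move=> cD D0.
(* Any fixed bump inside the interval serves for normalisation. *)
pose b0 : R -> R := bump (4^-1) (2^-1).
pose m0 := \int[mu]_(x in `]0, 1[) b0 x.
have m0_gt0 : 0 < m0 by apply: bump_integral_gt0; lra.
pose k := m0^-1 * \int[mu]_(x in `]0, 1[) (D x * b0 x).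
exists k => x0 x01; apply/eqP/negPn/negP => Dk.
have bump_cont c d : {within `[0, 1], continuous (bump c d : R -> R)}.
  exact/continuous_subspaceT/bump_algebra_continuous/bump_in_algebra.
have int_bump c d : mu.-integrable `]0, 1[ (EFin \o (bump c d : R -> R)).
  exact: continuous_integrable_oo.
have int_Dbump c d : mu.-integrable `]0, 1[ (EFin \o (fun x => D x * bump c d x)).
  by apply: continuous_integrable_oo => x; apply: continuousM;
    [exact: cD|exact: bump_cont].
have int_b0 : mu.-integrable `]0, 1[ (EFin \o b0) by exact: int_bump.
have int_Db0 : mu.-integrable `]0, 1[ (EFin \o (fun x => D x * b0 x)).
  exact: int_Dbump.
have main c d : 0 < c -> c < d -> d < 1 ->
    \int[mu]_(x in `]0, 1[) ((D x - k) * bump c d x) = 0.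
  move=> c0 cd d1.
  pose r := m0^-1 * \int[mu]_(x in `]0, 1[) bump c d x.
  pose theta := (bump c d + (- r) *: b0) : R -> R.
  have thetaE x : theta x = bump c d x - r * b0 x by rewrite /theta !fctE /GRing.scale/= mulNr.
  have Atheta : bump_algebra theta.
    by apply: bump_add; [|apply: bump_scale]; exact: bump_in_algebra.
  have [phi tphi phi'] : exists2 phi, test_fun phi & (phi^`())%classic = theta.
    apply: (@bump_algebra_primitive_test theta (Num.min c 4^-1) (Num.max d 2^-1)) => //.
    - by rewrite lt_min c0; lra.
    - by rewrite gt_min !lt_max cd.
    - by rewrite gt_max d1; lra.
    - move=> x; rewrite in_itv/= ge_min le_max negb_and !negb_or -!ltNge => xout.
      rewrite thetaE /b0 [bump c d x]bump_out; last first.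
        by apply/negP => /andP[? ?]; case/orP: xout => /andP[? ?]; lra.
      rewrite bump_out ?mulr0 ?subr0//.
      by apply/negP => /andP[? ?]; case/orP: xout => /andP[? ?]; lra.
    - transitivity (\int[mu]_(x in `]0, 1[) (bump c d x - r * b0 x)).
        by apply: eq_Rintegral => x _; exact: thetaE.
      rewrite RintegralB//; last exact: integrable_scale.
      rewrite RintegralZl// -/m0 /r mulrAC mulVf ?mul1r ?subrr//.
      by rewrite gt_eqF.
  have Db : \int[mu]_(x in `]0, 1[) (D x * bump c d x) -
      r * \int[mu]_(x in `]0, 1[) (D x * b0 x) = 0.
    rewrite -[RHS](D0 _ tphi) phi' -RintegralZl// -RintegralB//; last exact: integrable_scale.
    by apply: eq_Rintegral => x _; rewrite thetaE; ring.
  transitivity (\int[mu]_(x in `]0, 1[) (D x * bump c d x - k * bump c d x)).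
    by apply: eq_Rintegral => x _; rewrite mulrBl.
  rewrite RintegralB//; last exact: integrable_scale.
  rewrite RintegralZl// -[RHS]Db; congr (_ - _); rewrite /k /r; ring.
pose s := D x0 - k.
have s0 : s != 0 by rewrite subr_eq0.
have [e e0 De] : exists2 e : R, 0 < e & forall x : R, `|x - x0| < e -> (x \in `]0, 1[) /\
    s ^+ 2 / 2 <= s * (D x - k).
  have [cDo _ _] := (continuous_within_itvP D (@ltr01 R)).1 cD.
  have sgt0 : 0 < `|s| / 2 by rewrite divr_gt0// normr_gt0.
  have /cvgrPdist_lt/(_ _ sgt0) nD := cDo _ x01.
  have n01 : \forall x \near x0, x \in `]0, 1[ by exact: near_in_itvoo.
  have [e /= e0 He] : \forall x \near x0, `|D x0 - D x| < `|s| / 2 /\ x \in `]0, 1[.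
    by near=> x; split; near: x.
  exists e => // x xe; have [|Dx ?] := He x; first by rewrite /ball/= distrC.
  split=> //.
  have -> : s * (D x - k) = s ^+ 2 - s * (D x0 - D x) by rewrite /s; ring.
  have : s * (D x0 - D x) <= s ^+ 2 / 2.
    rewrite (le_trans (ler_norm _))// normrM -(real_normK (num_real s)).
    rewrite expr2 -mulrA ler_wpM2l// ltW//.
  lra.
have [h /andP[h0 he]] : exists h, 0 < h < e by exists (e / 2); lra.
have Dh x : x0 - h <= x <= x0 + h -> (x \in `]0, 1[) /\ s ^+ 2 / 2 <= s * (D x - k).
  by move=> xh; apply: De; rewrite ltr_norml; lra.
have [|c01 _] := Dh (x0 - h); first lra.
have [|d01 _] := Dh (x0 + h); first lra.
move: c01 d01; rewrite !in_itv/= => /andP[c0 _] /andP[_ d1].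
have cd : x0 - h < x0 + h by lra.
have := main _ _ c0 cd d1.
set b := bump (x0 - h) (x0 + h) => mb.
have bpos : 0 < \int[mu]_(x in `]0, 1[) b x by exact: bump_integral_gt0.
have int_b : mu.-integrable `]0, 1[ (EFin \o b) by exact: int_bump.
have s2 : 0 < s ^+ 2 / 2 by rewrite divr_gt0// exprn_even_gt0.
have int_Dkb : mu.-integrable `]0, 1[ (EFin \o (fun x => (D x - k) * b x)).
  have cDk : {within `[0, 1], continuous (fun x => D x - k)}.
    by move=> x; apply: (@cvgB _ R^o); [exact: cD|exact: cvg_cst].
  apply: continuous_integrable_oo => x.
  by apply: cvgM; [exact: cDk|exact: bump_cont].
have : s ^+ 2 / 2 * \int[mu]_(x in `]0, 1[) b x <=
    s * \int[mu]_(x in `]0, 1[) ((D x - k) * b x).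
  rewrite -!RintegralZl//; apply: le_Rintegral => //; try exact: integrable_scale.
  move=> x _; rewrite mulrA.
  have [/andP[xl xr]|/bump_out xout] := boolP (x0 - h < x < x0 + h).
    by rewrite ler_wpM2r ?bump_ge0// (Dh x _).2// !ltW.
  by rewrite /b xout !mulr0.
by rewrite mb mulr0 leNgt mulr_gt0.
Unshelve. all: by end_near. Qed.

End du_bois_reymond.

(** * Weak derivatives with zero initial trace *)

Section weak_derivatives.
Context {R : realType}.
Notation mu := (@lebesgue_measure R).
Implicit Types (v w phi : R -> R).

Lemma Rintegral_derive1 phi y : (forall x, derivable phi x 1) ->
  continuous (phi^`())%classic -> y < 1 ->
  \int[mu]_(x in `]y, 1[) (phi^`())%classic x = phi 1 - phi y.
Proof.
move=> dphi cphi' y1; have cphi := derivable_continuous dphi.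
have FTC : (\int[mu]_(x in `[y, 1%R]) ((phi^`())%classic x)%:E =
    (phi 1)%:E - (phi y)%:E)%E.
  apply: (@continuous_FTC2 R (phi^`())%classic phi y 1 y1).
  - exact: continuous_subspaceT.
  - split => [x _||]; first exact: dphi.
    + exact/cvg_at_right_filter/cphi.
    + exact/cvg_at_left_filter/cphi.
  - by move=> x _.
have -> : phi 1 - phi y = fine ((phi 1)%:E - (phi y)%:E)%E by [].
rewrite -FTC; congr fine; rewrite (integral_itv_bndoo true false)//.
apply/measurable_EFinP; apply: measurable_funTS.
exact: continuous_measurable_fun.
Qed.

Lemma test_fun_derivable phi : test_fun phi ->
  (forall x, derivable phi x 1) /\ continuous (phi^`())%classic.
Proof.
case=> s _; split=> [x|]; first exact: (s 0%N).
by apply: derivable_continuous => x; exact: (s 1%N).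
Qed.

(** Integration by parts when one factor is only a primitive of an integrable
    function: exchange the integrals over the triangle. *)
Lemma primitive_weak_deriv w phi : mu.-integrable `]0, 1[ (EFin \o w) ->
  test_fun phi ->
  \int[mu]_(x in `]0, 1[) ((phi^`())%classic x * \int[mu]_(y in `]0, x[) w y) =
  - \int[mu]_(y in `]0, 1[) (w y * phi y).
Proof.
move=> intw tphi; have [dphi cphi'] := test_fun_derivable tphi.
have phi1 : phi 1 = 0.
  by case: tphi => _ [c [d [_ d1 ->]]]//; rewrite in_itv/= [1 <= d]leNgt d1 andbF.
have cphi := derivable_continuous dphi.
have [mphi' [M phi'M]] := continuous_bounded_measurable_oo (continuous_subspaceT cphi').
have [mphi [N phiN]] := continuous_bounded_measurable_oo (continuous_subspaceT cphi).
rewrite (triangle_fubini mphi' phi'M intw) -mulN1r -RintegralZl//; last first.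
  have := @integrable_mul_bounded _ _ R mu _ phi w N (measurable_itv _) mphi phiN intw.
  by apply: eq_integrable => // x _ /=; rewrite mulrC.
apply: eq_Rintegral => y; rewrite inE/= in_itv/= => /andP[_ y1].
rewrite Rintegral_derive1// phi1; ring.
Qed.

(** The closed-interval primitive of the extension by zero is continuous up to
    the endpoints, as needed to compare it with traces. *)
Lemma primitive_continuous w : mu.-integrable `]0, 1[ (EFin \o w) ->
  exists W : R -> R, [/\ {within `[0, 1], continuous W}, W 0 = 0 &
    forall x : R, x \in `]0, 1[ -> W x = \int[mu]_(y in `]0, x[) w y].
Proof.
move=> intw; pose w0 : R -> R := w \_ (`]0, 1[ : set R).
have int0 : mu.-integrable setT (EFin \o w0).
  have := (@integrable_mkcond _ _ R mu `]0, 1[ (EFin \o w) (measurable_itv _)).1 intw.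
  by apply: eq_integrable => // x _; rewrite /w0 /= !patchE; case: ifP.
exists (fun x : R => \int[mu]_(y in `[0, x]) w0 y); split.
- by apply: parameterized_integral_continuous => //; exact: integrableS int0.
- by rewrite set_itv1 Rintegral_set1.
- move=> x /[!in_itv]/= /andP[x0 x1].
  rewrite Rintegral_itv_bndo_bndc; last first.
    apply: integrableS intw => //; apply: subset_itvl.
    by rewrite bnd_simp ltW.
  rewrite [LHS]Rintegral_mkcond [RHS]Rintegral_mkcond; apply: eq_Rintegral => y _.
  rewrite /w0 !patchE !mem_setE !in_itv/=.
  have [yx|_] := leP y x; last by rewrite !andbF.
  by rewrite !andbT (le_lt_trans yx x1) andbT; case: ltgtP.
Qed.

(** The continuous representative of [v] and the primitive of [w] differ by a
    constant by the du Bois-Reymond lemma, and the trace at 0 makes it zero. *)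
Lemma weak_deriv_primitive v w : weak_deriv v w -> has_trace v 0 0 ->
  \forall x \ae mu, x \in `]0, 1[ -> v x = \int[mu]_(y in `]0, x[) w y.
Proof.
move=> [L2v L2w wd] [vc [cvc vvc vc0]].
have intw : mu.-integrable `]0, 1[ (EFin \o w).
  by apply: L2_integrable L2w => //; exact: lebesgue_oo_lty.
have intv : mu.-integrable `]0, 1[ (EFin \o v).
  by apply: L2_integrable L2v => //; exact: lebesgue_oo_lty.
have [W [cW W0 WE]] := primitive_continuous intw.
have cD : {within `[0, 1], continuous (fun x => vc x - W x)}.
  by move=> x; apply: (@cvgB _ R^o); [exact: cvc|exact: cW].
have [k Dk] : exists k, forall x, x \in `]0, 1[ -> vc x - W x = k.
  apply: du_bois_reymond_continuous => // phi tphi.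
  have [dphi cphi'] := test_fun_derivable tphi.
  have cphi'I : {within `[0, 1], continuous (phi^`())%classic}.
    exact: continuous_subspaceT.
  have [mphi' [M phi'M]] := continuous_bounded_measurable_oo cphi'I.
  have intM (f : R -> R) : {within `[0, 1], continuous f} ->
      mu.-integrable `]0, 1[ (EFin \o (fun x => f x * (phi^`())%classic x)).
    by move=> cf; apply: continuous_integrable_oo => x; apply: cvgM;
      [exact: cf|exact: cphi'I].
  transitivity (\int[mu]_(x in `]0, 1[) (vc x * (phi^`())%classic x
      - W x * (phi^`())%classic x)).
    by apply: eq_Rintegral => x _; rewrite mulrBl.
  rewrite RintegralB//; [|exact: intM..].
  have <- : \int[mu]_(x in `]0, 1[) (v x * (phi^`())%classic x) =
      \int[mu]_(x in `]0, 1[) (vc x * (phi^`())%classic x).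
    apply: ae_eq_Rintegral => //.
    - have := @integrable_mul_bounded _ _ R mu _ _ v M (measurable_itv _) mphi' phi'M intv.
      by apply: eq_integrable => // x _ /=; rewrite mulrC.
    - by apply/measurable_EFinP; exact: measurable_int (intM _ cvc).
    - by apply: ae_imp vvc => x h /h ->.
  rewrite wd// -primitive_weak_deriv//; apply/eqP; rewrite subr_eq0.
  apply/eqP/eq_Rintegral => x; rewrite inE/= => x01.
  by rewrite WE// mulrC.
have k0 : k = 0.
  have [_ D0 _] := (continuous_within_itvP _ (@ltr01 R)).1 cD.
  rewrite vc0 W0 subr0 in D0.
  have Dkk : vc x - W x @[x --> 0^'+] --> k.
    apply: cvg_near_cst; near=> x; apply: Dk; rewrite in_itv/=; apply/andP; split.
      by near: x; exact: nbhs_right_gt.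
    by near: x; exact: nbhs_right_lt.
  exact: (cvg_unique _ Dkk D0).
apply: ae_imp vvc => x vx x01; rewrite vx// -WE//.
by apply/eqP; rewrite -subr_eq0 Dk// k0.
Unshelve. all: by end_near. Qed.

End weak_derivatives.

(** * Uniqueness from exponential moments *)

Lemma Rintegral_dominated_cvg d (T : measurableType d) (R : realType)
    (mu : {measure set T -> \bar R}) (D : set T) (h : nat -> T -> R) (l f : T -> R)
    (M : R) : measurable D -> mu.-integrable D (EFin \o f) ->
  (forall n, measurable_fun D (h n)) -> measurable_fun D l ->
  (forall n x, D x -> `|h n x| <= M) ->
  (\forall x \ae mu, D x -> h n x @[n --> \oo] --> l x) ->
  \int[mu]_(x in D) (h n x * f x) @[n --> \oo] -->
  \int[mu]_(x in D) (l x * f x).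
Proof.
move=> mD intf mh ml hM hl.
have mf : measurable_fun D f by apply/measurable_EFinP; exact: measurable_int intf.
have [|||||ilf _ cv] := @dominated_convergence _ _ R mu D mD
  (fun n x => (h n x * f x)%:E) (fun x => (l x * f x)%:E)
  (fun x => (M * `|f x|)%:E).
- by move=> n; apply/measurable_EFinP/measurable_funM.
- exact/measurable_EFinP/measurable_funM.
- apply: ae_imp hl => x hx Dx; apply: cvg_EFin; first exact: nearW.
  by apply: cvgMl; exact: hx.
- exact/integrable_scale/integrable_norm.
- apply/aeW => x n Dx /=; rewrite lee_fin normrM ler_wpM2r//; exact: hM.
- apply: fine_cvg; rewrite /Rintegral fineK; first exact: cv.
  exact: integrable_fin_num.
Qed.

Section exponential_moments.
Context {R : realType}.
Notation mu := (@lebesgue_measure R).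
Implicit Types (f : R -> R) (T s t x y : R).

(** Lebesgue's differentiation theorem. *)
Lemma primitive_eq0_ae T f : mu.-integrable `]0, T[ (EFin \o f) ->
  (forall x, x \in `]0, T[ -> \int[mu]_(y in `]0, x[) f y = 0) ->
  \forall x \ae mu, x \in `]0, T[ -> f x = 0.
Proof.
move=> intf F0; pose f0 : R -> R := f \_ (`]0, T[ : set R).
have int0 : mu.-integrable setT (EFin \o f0).
  have := (@integrable_mkcond _ _ R mu `]0, T[ (EFin \o f) (measurable_itv _)).1 intf.
  by apply: eq_integrable => // x _; rewrite /f0 /= !patchE; case: ifP.
have loc0 := integrable_locally (measurable_itv _) intf.
have int0y y : mu.-integrable `]-oo, y] (EFin \o f0) by exact: integrableS int0.
apply: ae_imp (FTC1Ny int0y loc0) => x [_ +] x0T.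
have -> : f0 x = f x by rewrite /f0 patchE mem_setE x0T.
move=> <-; rewrite derive1E.
transitivity ('D_1 (cst 0 : R -> R) x); last exact: derive_cst.
apply: near_eq_derive; near=> y.
have y0T : y \in `]0, T[ by near: y; exact: near_in_itvoo.
rewrite -[RHS](F0 y y0T) (Rintegral_itv_bndo_bndc (r := y)); last first.
  move: y0T; rewrite in_itv/= => /andP[_ /ltW yT].
  by apply: integrableS intf => //; apply: subset_itvl; rewrite bnd_simp.
rewrite [LHS]Rintegral_mkcond [RHS]Rintegral_mkcond; apply: eq_Rintegral => z _.
move: y0T; rewrite /f0 !patchE !mem_setE !in_itv/= => /andP[_ yT].
have [zy|_] := leP z y; last by rewrite !andbF.
by rewrite (le_lt_trans zy yT) !andbT.
Unshelve. all: by end_near. Qed.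

Lemma le_harmonic_cvg (a : R^nat) (l K : R) :
  (forall n, `|a n.+1 - l| <= K * (n.+1%:R)^-1) -> a @ \oo --> l.
Proof.
move=> aK; rewrite -cvg_shiftS; apply/cvgrPdist_le => e e0.
near=> n; rewrite distrC (le_trans (aK n))// ler_pdivrMr ?ltr0n//.
rewrite mulrC -ler_pdivrMr// (@le_trans _ _ n%:R) ?ler_nat//.
by near: n; exact: nbhs_infty_ger.
Unshelve. all: by end_near. Qed.

(** A smoothed Heaviside function, sharper as [n] grows.  Its expansion in powers
    of [expR (n * y)] reduces its integrals to exponential moments. *)
Definition soft_step (n : nat) (y : R) : R := 1 - expR (- expR (n%:R * y)).

Lemma soft_step_bounded n y : 0 <= soft_step n y <= 1.
Proof.
rewrite /soft_step subr_ge0 expR_le1 oppr_le0 expR_ge0/=.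
by rewrite lerBlDr lerDl expR_ge0.
Qed.

Lemma soft_step_cvg y : y != 0 ->
  soft_step n y @[n --> \oo] --> ((0 < y)%R%:R : R).
Proof.
move=> y0; apply: (@le_harmonic_cvg _ _ `|y|^-1) => n.
have ny0 : 0 < n.+1%:R * `|y| by rewrite mulr_gt0// normr_gt0.
rewrite -invfM mulrC.
have [yneg|ypos|y00] := ltgtP y 0; last by rewrite y00 eqxx in y0.
- rewrite subr0 ger0_norm; last by case/andP: (soft_step_bounded n.+1 y).
  rewrite ltr0_norm// in ny0 *.
  have h1 := expR_ge1Dx (- expR (n.+1%:R * y)).
  apply: (@le_trans _ _ (expR (n.+1%:R * y))).
    by rewrite /soft_step; lra.
  rewrite -[leLHS]invrK lef_pV2 ?posrE ?invr_gt0 ?expR_gt0//.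
  rewrite -expRN -mulrN (le_trans _ (expR_ge1Dx _))// lerDr//.
- rewrite gtr0_norm// in ny0 *.
  rewrite /soft_step addrAC subrr sub0r normrN ger0_norm ?expR_ge0//.
  rewrite expRN lef_pV2 ?posrE ?expR_gt0//.
  rewrite (le_trans _ (ltW (expR_gt1Dx _))) ?gt_eqF ?expR_gt0//.
  rewrite (le_trans _ (_ : expR (n.+1%:R * y) <= _)) ?lerDr//.
  by rewrite (le_trans _ (expR_ge1Dx _))// lerDr.
Qed.

Lemma norm_exp_series_le (y M : R) m : `|y| <= M ->
  `|series (exp_coeff y) m| <= expR M.
Proof.
move=> yM; apply: (@le_trans _ _ (series (exp_coeff M) m)).
  rewrite /series/= (le_trans (ler_norm_sum _ _ _))//; apply: ler_sum => i _.
  rewrite /exp_coeff/= normrM normfV normr_nat ler_wpM2r ?invr_ge0//.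
  by rewrite normrX lerXn2r// nnegrE (le_trans _ yM).
have M0 : 0 <= M by rewrite (le_trans _ yM).
apply: nondecreasing_cvgn_le; last exact: is_cvg_series_exp_coeff.
by apply/nondecreasing_series => i _ _; exact: exp_coeff_ge0.
Qed.

Lemma measurable_expR_affine (D : set R) (k c : R) :
  measurable_fun D (fun t : R => expR (k * (c - t))).
Proof.
apply: measurable_funTS; apply: continuous_measurable_fun => t.
apply: continuous_comp; last exact: continuous_expR.
apply: cvgM; first exact: cvg_cst.
by apply: cvgB; [exact: cvg_cst|exact: cvg_id].
Qed.

Lemma norm_expR_affine_le (n : nat) T t : t \in `]0, T[ ->
  `|expR (n%:R * (T - t))| <= expR (n%:R * T).
Proof.
rewrite in_itv/= => /andP[t0 _].
by rewrite ger0_norm ?expR_ge0// ler_expR ler_wpM2l// gerBl ltW.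
Qed.

(** The k-th term of the exponential series of [- expR (N * (x - t))] is a
    multiple of [expR (k * N * (T - t))].  Its integral against [f] is an
    exponential moment, so that the partial sums without their constant term are
    bounded by those of the exponential series at [expR (- N * (T - x) / 2)]. *)
Lemma exp_moment_series_bound T f x C (N m : nat) : 0 < T ->
  mu.-integrable `]0, T[ (EFin \o f) -> x < T ->
  (forall n, `|\int[mu]_(t in `]0, T[) (expR (n%:R * (T - t)) * f t)| <=
    C * expR ((T - x) / 2 * n%:R)) ->
  `|\int[mu]_(t in `]0, T[)
     ((series (exp_coeff (- expR (N%:R * (x - t)))) m.+1 - 1) * f t)| <=
    C * (series (exp_coeff (expR (- (N%:R * ((T - x) / 2))))) m.+1 - 1).
Proof.
move=> T0 intf xT H.
have intE n : mu.-integrable `]0, T[ (EFin \o (fun t => expR (n%:R * (T - t)) * f t)).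
  apply: (integrable_mul_bounded (M := expR (n%:R * T))) => //.
    exact: measurable_expR_affine.
  by move=> t; exact: norm_expR_affine_le.
pose X t := - expR (N%:R * (x - t)).
pose q := expR (- (N%:R * ((T - x) / 2))).
have termE k t : exp_coeff (X t) k * f t =
    ((-1) ^+ k / k`!%:R * expR (- ((k * N)%:R * (T - x)))) *
    (expR ((k * N)%:R * (T - t)) * f t).
  rewrite /exp_coeff/= /X [(- expR _) ^+ _]exprNn -expRM_natl [RHS]mulrA; congr (_ * _).
  rewrite -[RHS]mulrA -expRD [LHS]mulrAC; congr (_ * _); congr expR.
  by rewrite natrM; ring.
have term_int k : mu.-integrable `]0, T[ (EFin \o (fun t => exp_coeff (X t) k * f t)).
  have h := @integrable_scale _ _ _ mu `]0, T[
    ((-1) ^+ k / k`!%:R * expR (- ((k * N)%:R * (T - x)))) _ (measurable_itv _) (intE (k * N)%N).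
  by apply: eq_integrable h => // t _ /=; rewrite termE.
have term_bound k : `|\int[mu]_(t in `]0, T[) (exp_coeff (X t) k * f t)| <=
    C * exp_coeff q k.
  have -> : \int[mu]_(t in `]0, T[) (exp_coeff (X t) k * f t) =
      ((-1) ^+ k / k`!%:R * expR (- ((k * N)%:R * (T - x)))) *
      \int[mu]_(t in `]0, T[) (expR ((k * N)%:R * (T - t)) * f t).
    by rewrite -RintegralZl//; apply: eq_Rintegral => t _; exact: termE.
  rewrite !normrM normrX normrN1 expr1n mul1r normfV normr_nat.
  rewrite [`|expR _|]ger0_norm ?expR_ge0//.
  apply: (le_trans (ler_wpM2l _ (H _))); first by rewrite mulr_ge0 ?invr_ge0 ?expR_ge0.
  rewrite le_eqVlt; apply/orP; left; apply/eqP.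
  have qk : q ^+ k = expR (- ((k * N)%:R * (T - x))) * expR ((T - x) / 2 * (k * N)%:R).
    by rewrite -expRD /q -expRM_natl; congr expR; rewrite natrM; field.
  by rewrite /exp_coeff/= qk; ring.
suff : mu.-integrable `]0, T[ (EFin \o (fun t => (series (exp_coeff (X t)) m.+1 - 1) * f t))
    /\ `|\int[mu]_(t in `]0, T[) ((series (exp_coeff (X t)) m.+1 - 1) * f t)| <=
       C * (series (exp_coeff q) m.+1 - 1) by case.
have S1 y : series (exp_coeff y) 1 = 1.
  by rewrite /series/= big_nat1 /exp_coeff/= expr0 fact0 divr1.
elim: m => [|m [IHi IHb]].
  have E0 : (fun t => (series (exp_coeff (X t)) 1 - 1) * f t) = fun=> 0.
    by apply/funext => t; rewrite S1 subrr mul0r.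
  rewrite E0 S1 subrr mulr0; split; first exact: integrable0.
  by rewrite /Rintegral integral0 normr0.
have SS y : series (exp_coeff y) m.+2 - 1 =
    (series (exp_coeff y) m.+1 - 1) + exp_coeff y m.+1.
  by rewrite /series/= big_nat_recr//= addrAC.
have ES : (fun t => (series (exp_coeff (X t)) m.+2 - 1) * f t) =
    fun t => (series (exp_coeff (X t)) m.+1 - 1) * f t + exp_coeff (X t) m.+1 * f t.
  by apply/funext => t; rewrite SS mulrDl.
rewrite ES; split.
  have := @integrableD _ _ R mu _ (measurable_itv _) _ _ IHi (term_int m.+1).
  by apply: eq_integrable.
rewrite RintegralD// SS mulrDr (le_trans (ler_normD _ _))// lerD//.
Qed.

(** If the exponential moments of [f] grow more slowly than every
    [expR (e * n)], then the integrals of [soft_step N (x - t) * f t] tend to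
    zero.  They also tend to the integral of [f] over [0 < t < x]. *)
Lemma exp_moments_eq0 T f : 0 < T -> mu.-integrable `]0, T[ (EFin \o f) ->
  (forall e, 0 < e -> exists C, forall n,
    `|\int[mu]_(t in `]0, T[) (expR (n%:R * (T - t)) * f t)| <=
    C * expR (e * n%:R)) ->
  \forall t \ae mu, t \in `]0, T[ -> f t = 0.
Proof.
move=> T0 intf H; apply: primitive_eq0_ae => // x /[!in_itv]/= /andP[x0 xT].
have s0 : 0 < (T - x) / 2 by rewrite divr_gt0// subr_gt0.
have [C HC] := H _ s0.
have C0 : 0 <= C.
  by have := HC 0%N; rewrite mulr0 expR0 mulr1; apply: le_trans.
have mX N : measurable_fun `]0, T[ (fun t : R => - expR (N%:R * (x - t))).
  by apply: measurableT_comp => //; exact: measurable_expR_affine.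
have mEX N : measurable_fun `]0, T[ (fun t : R => expR (- expR (N%:R * (x - t)))).
  by apply: (measurableT_comp _ (mX N)); exact: measurable_expR.
have XM N t : t \in `]0, T[ -> `|- expR (N%:R * (x - t))| <= expR (N%:R * T).
  rewrite in_itv/= => /andP[t0 _].
  rewrite normrN ger0_norm ?expR_ge0// ler_expR ler_wpM2l//.
  by rewrite lerBlDr (le_trans (ltW xT))// lerDl ltW.
have mS N m : measurable_fun `]0, T[
    (fun t : R => series (exp_coeff (- expR (N%:R * (x - t)))) m).
  by apply: measurable_sum => i; apply: measurable_funM => //; exact: measurable_funX.
have bound N : `|\int[mu]_(t in `]0, T[) (soft_step N (x - t) * f t)| <=
    C * (expR (expR (- (N%:R * ((T - x) / 2)))) - 1).
  have cv : \int[mu]_(t in `]0, T[)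
      ((series (exp_coeff (- expR (N%:R * (x - t)))) m.+1 - 1) * f t) @[m --> \oo] -->
      \int[mu]_(t in `]0, T[) ((expR (- expR (N%:R * (x - t))) - 1) * f t).
    apply: (Rintegral_dominated_cvg (M := expR (expR (N%:R * T)) + 1)) => //.
    - by move=> m; apply: measurable_funB => //; exact: mS.
    - by apply: measurable_funB => //; exact: mEX.
    - move=> m t tT; rewrite (le_trans (ler_normB _ _))// normr1 lerD2r.
      by apply: norm_exp_series_le; exact: XM.
    - apply/aeW => t tT; apply: cvgB; last exact: cvg_cst.
      by rewrite (cvg_shiftS (series _)); exact: is_cvg_series_exp_coeff.
  have -> : \int[mu]_(t in `]0, T[) (soft_step N (x - t) * f t) =
      - \int[mu]_(t in `]0, T[) ((expR (- expR (N%:R * (x - t))) - 1) * f t).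
    rewrite -[RHS]mulN1r -RintegralZl//.
      by apply: eq_Rintegral => t _; rewrite /soft_step; ring.
    apply: (integrable_mul_bounded (M := 1)) => //.
      by apply: measurable_funB => //; exact: mEX.
    move=> t _; have /andP[h0 h1] := soft_step_bounded N (x - t).
    by rewrite -normrN opprB ger0_norm.
  rewrite normrN -(cvg_lim _ (cvg_norm cv))//; apply: limr_le.
    by apply: cvgP; exact: cvg_norm cv.
  apply: nearW => m; apply: (le_trans (exp_moment_series_bound _ _ _ _ _ HC)) => //.
  rewrite ler_wpM2l// lerD2r.
  rewrite (le_trans (ler_norm _))// norm_exp_series_le// ger0_norm//; exact: expR_ge0.
have lim0 : \int[mu]_(t in `]0, T[) (soft_step N (x - t) * f t) @[N --> \oo] --> (0 : R).
  apply: (@le_harmonic_cvg _ _ (C * (expR 1 / ((T - x) / 2)))) => N.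
  rewrite subr0 (le_trans (bound _))// -mulrA ler_wpM2l//.
  set q := expR (- _).
  have q1 : q <= 1 by rewrite /q expR_le1 oppr_le0 mulr_ge0// ltW.
  have qN : q <= ((T - x) / 2)^-1 * (N.+1%:R)^-1.
    rewrite /q expRN -invfM lef_pV2 ?posrE ?expR_gt0 ?mulr_gt0 ?subr_gt0//.
    by rewrite mulrC (le_trans _ (expR_ge1Dx _))// lerDr.
  have := expR_ge1Dx (- q); have := expR_ge0 q => eq0 eq1.
  have : expR q * expR (- q) = 1 by rewrite expRN divff// gt_eqF// expR_gt0.
  move=> eq2; apply: (@le_trans _ _ (expR q * q)).
    by have := ler_wpM2l eq0 eq1; rewrite eq2 mulrDr mulr1; lra.
  rewrite -[leRHS]mulrA; apply: ler_pM => //; first exact: expR_ge0.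
  by rewrite ler_expR.
have lim1 : \int[mu]_(t in `]0, T[) (soft_step N (x - t) * f t) @[N --> \oo] -->
    \int[mu]_(t in `]0, T[) ((0 < x - t)%R%:R * f t).
  apply: (Rintegral_dominated_cvg (M := 1)) => //.
  - by move=> N; apply: measurable_funB => //; exact: mEX.
  - apply: measurable_bool_natr.
    by apply: measurable_fun_ltr => //; exact: measurable_funB.
  - move=> N t _; have /andP[h0 h1] := soft_step_bounded N (x - t).
    by rewrite ger0_norm.
  (* At t = x the soft steps keep the constant value 1 - 1/e, but a point is null. *)
  - exists [set x]; split; [exact: measurable_set1|exact: lebesgue_measure_set1|].
    move=> t /= /not_implyP[_ nc]; apply/eqP/negPn/negP => tx; apply: nc.
    by apply: soft_step_cvg; rewrite subr_eq0 eq_sym.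
have : \int[mu]_(t in `]0, T[) ((0 < x - t)%R%:R * f t) = 0.
  exact: (cvg_unique _ lim1 lim0).
rewrite (Rintegral_below _ _ (ltW xT)) => E; rewrite -[RHS]E.
by apply: eq_Rintegral => t _; rewrite subr_gt0.
Qed.

End exponential_moments.

(** * Exponential moments of the fractional integral *)

Section fractional_integral.
Context {R : realType}.
Notation mu := (@lebesgue_measure R).
Implicit Types (w : R -> R) (a T s t r la : R).

Lemma lebesgue_measure_translate s (A : set R) : measurable A ->
  pushforward mu ((fun t => t - s) : _ -> measurableTypeR R) A = mu A.
Proof.
have ms : measurable_fun setT ((fun t => t - s) : measurableTypeR R -> measurableTypeR R).
  exact: measurable_funB.
move=> mA; apply/esym/lebesgue_measure_unique => //= _ [[b c]] _ <-.
rewrite /pushforward (_ : _ @^-1` _ = `]b + s, c + s]%classic); last first.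
  by apply/seteqP; split=> t /=; rewrite !in_itv/= ltrBrDr lerBlDr.
rewrite !lebesgue_measure_itv/= !lte_fin ltrD2r.
by case: ifPn => // _; rewrite -!EFinB; congr EFin; ring.
Qed.

Lemma ge0_integral_translate s (D : set R) (F : R -> \bar R) :
  measurable D -> measurable_fun D F -> {in D, forall y, (0 <= F y)%E} ->
  (\int[mu]_(t in (fun t => t - s)%R @^-1` D) F (t - s)%R = \int[mu]_(y in D) F y)%E.
Proof.
move=> mD mF F0.
have ms : measurable_fun setT ((fun t => t - s) : measurableTypeR R -> measurableTypeR R).
  exact: measurable_funB.
rewrite -(ge0_integral_pushforward ms mu mD mF F0).
by apply: eq_measure_integral => //= A mA _; exact: lebesgue_measure_translate.
Qed.

(** The real integral of a nonnegative function of infinite integral is 0, so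
    that a nonzero [Gamma a] already gives convergence. *)
Lemma Gamma_integrable a : Gamma a != 0 ->
  mu.-integrable `]0, +oo[ (EFin \o (fun s : R => s `^ (a - 1) * expR (- s))).
Proof.
rewrite /Gamma /Rintegral => G0; apply/integrableP; split.
  apply/measurable_EFinP; apply: measurable_funM.
    by apply: measurable_funTS; exact: measurable_powR.
  by apply: measurable_funTS; apply: measurableT_comp => //; exact: measurable_expR.
under eq_integral do rewrite /= ger0_norm ?mulr_ge0 ?powR_ge0 ?expR_ge0//.
rewrite ltey; apply: contra_neq G0 => E.
by rewrite E.
Qed.

Lemma fractional_kernel_integrable a T : Gamma a != 0 ->
  mu.-integrable `]0, T[ (EFin \o (fun s : R => s `^ (a - 1))).
Proof.
move=> /Gamma_integrable iG.
have iG' : mu.-integrable `]0, T[ (EFin \o (fun s : R => s `^ (a - 1) * expR (- s))).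
  by apply: integrableS iG => // s/=; rewrite !in_itv/= => /andP[->].
have me : measurable_fun `]0, T[ (expR : R -> R).
  by apply: measurable_funTS; exact: measurable_expR.
have := @integrable_mul_bounded _ _ R mu _ (expR : R -> R) _ (expR T) (measurable_itv _) me _ iG'.
have -> : (fun s => expR s * (s `^ (a - 1) * expR (- s))) = (fun s : R => s `^ (a - 1)).
  by apply/funext => s; rewrite mulrCA -expRD subrr expR0 mulr1.
apply=> s; rewrite /= in_itv/= => /andP[_ sT].
by rewrite ger0_norm ?expR_ge0// ler_expR ltW.
Qed.

(** The substitution [r = t - s]. *)
Lemma integral_shifted_kernel a T s la : 0 < s ->
  (\int[mu]_(t in `]0%R, T[) ((s < t)%R%:R * (expR (la * (T - t)) * (t - s) `^ (a - 1)))%:E =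
   \int[mu]_(r in `]0%R, (T - s)%R[) (expR (la * (T - s - r)) * r `^ (a - 1))%:E)%E.
Proof.
move=> s0; pose F (r : R) := (expR (la * (T - s - r)) * r `^ (a - 1))%:E.
have mF : measurable_fun `]0, T - s[ F.
  apply/measurable_EFinP; apply: measurable_funM; first exact: measurable_expR_affine.
  by apply: measurable_funTS; exact: measurable_powR.
have F0 : {in `]0, T - s[%classic, forall r, (0 <= F r)%E}.
  by move=> r _; rewrite lee_fin mulr_ge0 ?expR_ge0 ?powR_ge0.
have <- := @ge0_integral_translate s _ F (measurable_itv _) mF F0.
rewrite [LHS]integral_mkcond [RHS]integral_mkcond; apply: eq_integral => t _.
have tE : (t \in (fun t => t - s) @^-1` `]0, T - s[%classic) = (s < t < T).
  by apply/idP/idP; rewrite inE/= in_itv/= ltrD2r subr_gt0.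
rewrite !patchE tE mem_setE in_itv/= /F.
have [st|st] := ltP s t; last by rewrite mul0r if_same.
rewrite (lt_trans s0 st)/= mul1r; case: ifP => // _; congr (_ * _)%:E; congr expR; ring.
Qed.

(** Tonelli: for fixed [s], the kernel integrates in [t] to at most its mass on
    [0 < r < T]. *)
Lemma shifted_kernel_integrable a T w : Gamma a != 0 ->
  mu.-integrable `]0, T[ (EFin \o w) ->
  (mu \x mu)%E.-integrable (`]0, T[ `*` `]0, T[)
    (fun z => (((z.1 < z.2)%R%:R * (z.2 - z.1) `^ (a - 1)) * w z.1)%:E).
Proof.
move=> G0 intw; have intk := fractional_kernel_integrable T G0.
have mw : measurable_fun `]0, T[ w by apply/measurable_EFinP; exact: measurable_int intw.
pose f s t := ((s < t)%R%:R * (t - s) `^ (a - 1)) * w s.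
have mf : measurable_fun (`]0, T[ `*` `]0, T[) (fun z => f z.1 z.2).
  apply: measurable_funM; last first.
    apply: (measurable_comp (F := `]0, T[%classic) _ _ mw) => //.
      by move=> _ [[s t] [/= As _] <-].
    exact: measurable_funTS measurable_fst.
  apply: measurable_funTS; apply: measurable_funM.
    apply: measurable_bool_natr; apply: measurable_fun_ltr.
      exact: measurable_fst.
    exact: measurable_snd.
  apply: (measurableT_comp (measurable_powR _)).
  by apply: measurable_funB; [exact: measurable_snd|exact: measurable_fst].
apply: (@integrable_rectP _ _ _ _ R mu mu _ _ (measurable_itv _) (measurable_itv _) f mf).
pose K := (\int[mu]_(r in `]0%R, T[) (r `^ (a - 1))%:E)%E.
have Koo : (K < +oo)%E by exact: integrable_lty intk.
have K0 : (0 <= K)%E by apply: integral_ge0 => r _; rewrite lee_fin powR_ge0.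
have mnw : measurable_fun `]0, T[ (fun s => `|w s|%:E).
  by apply/measurable_EFinP; exact: measurableT_comp.
apply: (@le_lt_trans _ _ (\int[mu]_(s in `]0%R, T[) (K * `|w s|%:E))%E); last first.
  rewrite ge0_integralZl//; apply: lte_mul_pinfty => //.
    by rewrite ge0_fin_numE.
  by have /integrableP[_] := intw.
apply: ge0_le_integral => //.
- by move=> s _; exact: integral_ge0.
- exact: (@measurable_rect_integral _ _ (measurableTypeR R) (measurableTypeR R) R mu
    _ _ (measurable_itv _) (measurable_itv _) f mf).
- exact: measurable_funeM.
- move=> s; rewrite /= in_itv/= => /andP[s0 sT].
  (* The shifted kernel with weight exponent 0 is the bare kernel. *)
  rewrite (_ : (fun _ => _) = fun t : R => (`|w s|%:E *
      ((s < t)%R%:R * (expR (0 * (T - t)) * (t - s) `^ (a - 1)))%:E)%E); last first.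
    apply/funext => t; rewrite /f mul0r expR0 mul1r normrM mulrC EFinM; congr (_ * _%:E)%E.
    by rewrite ger0_norm// mulr_ge0 ?powR_ge0.
  rewrite ge0_integralZl//; last 2 first.
  + apply/measurable_EFinP; apply: measurable_funM.
      by apply: measurable_bool_natr; exact: measurable_fun_ltr.
    apply: measurable_funM; first exact: measurable_expR_affine.
    apply: measurable_funTS; apply: (measurableT_comp (measurable_powR _)).
    exact: measurable_funB.
  + by move=> t _; rewrite lee_fin !mulr_ge0 ?expR_ge0 ?powR_ge0.
  rewrite integral_shifted_kernel// muleC lee_wpmul2r// /K.
  under eq_integral do rewrite mul0r expR0 mul1r.
  apply: ge0_subset_integral => //.
  + by apply/measurable_EFinP; apply: measurable_funTS; exact: measurable_powR.
  + by move=> t _; rewrite lee_fin powR_ge0.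
  + by apply: subset_itvl; rewrite bnd_simp gerBl ltW.
Qed.

(** By the substitution [r = t - s], the two integrals differ by one over
    [T - s <= r < T].  There the exponential weight [expR (n * (T - s - r))] is
    at most 1, so the difference is bounded uniformly in [n]. *)
Lemma shifted_kernel_truncation a T s n : Gamma a != 0 -> 0 < s < T ->
  mu.-integrable `]0, T[ (EFin \o (fun t : R =>
    (s < t)%R%:R * (expR (n%:R * (T - t)) * (t - s) `^ (a - 1)))) /\
  `|\int[mu]_(t in `]0, T[)
      ((s < t)%R%:R * (expR (n%:R * (T - t)) * (t - s) `^ (a - 1))) -
    (\int[mu]_(r in `]0, T[) (expR (- (n%:R * r)) * r `^ (a - 1))) *
      expR (n%:R * (T - s))| <= \int[mu]_(r in `]0, T[) (r `^ (a - 1)).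
Proof.
move=> G0 /andP[s0 sT]; have intk := fractional_kernel_integrable T G0.
have T0 := lt_trans s0 sT.
pose g r := expR (n%:R * (T - s - r)) * r `^ (a - 1).
have intg : mu.-integrable `]0, T[ (EFin \o g).
  apply: (integrable_mul_bounded (M := expR (n%:R * T))) => //.
    exact: measurable_expR_affine.
  move=> r; rewrite /= in_itv/= => /andP[r0 rT].
  by rewrite ger0_norm ?expR_ge0// ler_expR ler_wpM2l//; lra.
have intgs : mu.-integrable `]0, T - s[ (EFin \o g).
  by apply: integrableS intg => //; apply: subset_itvl; rewrite bnd_simp gerBl ltW.
have Ee := @integral_shifted_kernel a T s n%:R s0.
split.
  apply/integrableP; split.
    apply/measurable_EFinP; apply: measurable_funM.
      by apply: measurable_bool_natr; exact: measurable_fun_ltr.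
    apply: measurable_funM; first exact: measurable_expR_affine.
    apply: measurable_funTS; apply: (measurableT_comp (measurable_powR _)).
    exact: measurable_funB.
  under eq_integral do rewrite gee0_abs ?lee_fin ?mulr_ge0 ?expR_ge0 ?powR_ge0//.
  by rewrite Ee; exact: integrable_lty intgs.
have -> : \int[mu]_(t in `]0, T[)
      ((s < t)%R%:R * (expR (n%:R * (T - t)) * (t - s) `^ (a - 1))) =
    \int[mu]_(r in `]0, T[) ((r < T - s)%R%:R * g r).
  by rewrite -Rintegral_below ?gerBl ?ltW// /Rintegral Ee.
have int1g : mu.-integrable `]0, T[ (EFin \o (fun r => (r < T - s)%R%:R * g r)).
  by apply: integrable_mul_bool => //; exact: measurable_fun_ltr.
have intek : mu.-integrable `]0, T[ (EFin \o (fun r : R => expR (- (n%:R * r)) * r `^ (a - 1))).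
  apply: (integrable_mul_bounded (M := 1)) => //.
    have := @measurable_expR_affine R `]0, T[ n%:R 0.
    by apply: eq_measurable_fun => r _; rewrite sub0r mulrN.
  move=> r; rewrite /= in_itv/= => /andP[r0 rT].
  by rewrite ger0_norm ?expR_ge0// expR_le1 oppr_le0 mulr_ge0// ltW.
have -> : (\int[mu]_(r in `]0, T[) (expR (- (n%:R * r)) * r `^ (a - 1))) *
    expR (n%:R * (T - s)) = \int[mu]_(r in `]0, T[) g r.
  rewrite -RintegralZr//; apply: eq_Rintegral => r _.
  by rewrite /g mulrAC -expRD; congr (expR _ * _); ring.
rewrite -RintegralB// (le_trans (le_normr_Rintegral _ _))//.
  by have := @integrableB _ _ R mu _ (measurable_itv _) _ _ int1g intg; apply: eq_integrable.
apply: le_Rintegral => //.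
  apply: integrable_norm.
  by have := @integrableB _ _ R mu _ (measurable_itv _) _ _ int1g intg; apply: eq_integrable.
move=> r _; have [_|rs] := ltP r (T - s).
  by rewrite mul1r subrr normr0 powR_ge0.
rewrite mul0r sub0r normrN ger0_norm ?mulr_ge0 ?expR_ge0 ?powR_ge0//.
rewrite ler_piMl ?powR_ge0// expR_le1 mulr_ge0_le0//; lra.
Qed.

(** The truncated Laplace transform of a convolution, multiplied by
    [expR (n * T)].  The product formula holds up to an error that does not
    depend on [n]. *)
Lemma fractional_laplace a T w n : Gamma a != 0 ->
  mu.-integrable `]0, T[ (EFin \o w) ->
  mu.-integrable `]0, T[ (EFin \o (J a w)) /\
  `|\int[mu]_(t in `]0, T[) (expR (n%:R * (T - t)) * J a w t) -
    (Gamma a)^-1 * (\int[mu]_(r in `]0, T[) (expR (- (n%:R * r)) * r `^ (a - 1))) *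
    \int[mu]_(t in `]0, T[) (expR (n%:R * (T - t)) * w t)| <=
  (Gamma a)^-1 * (\int[mu]_(r in `]0, T[) (r `^ (a - 1))) *
    \int[mu]_(t in `]0, T[) `|w t|.
Proof.
move=> G0 intw; set c := (Gamma a)^-1; set ka := \int[mu]_(r in _) (expR _ * _ `^ _).
set K := \int[mu]_(r in _) (_ `^ _).
have c_ge0 : 0 <= c.
  rewrite invr_ge0; apply: Rintegral_ge0 => r _.
  by rewrite mulr_ge0 ?powR_ge0 ?expR_ge0.
pose E (t : R) := expR (n%:R * (T - t)).
have mE : measurable_fun `]0, T[ E by exact: measurable_expR_affine.
have EM t : t \in `]0, T[ -> `|E t| <= expR (n%:R * T).
  exact: norm_expR_affine_le.
pose G t s := ((s < t)%R%:R * (t - s) `^ (a - 1)) * w s.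
have intG : (mu \x mu)%E.-integrable (`]0, T[ `*` `]0, T[) (fun z => (G z.1 z.2)%:E).
  exact: (@rect_integrable_swap _ _ _ _ R mu mu _ _ (measurable_itv _) (measurable_itv _)
    (fun s t => G t s) (shifted_kernel_integrable G0 intw)).
have intGs := @rect_integrable_Rintegral _ _ _ _ R mu mu _ _ (measurable_itv _)
  (measurable_itv _) G intG.
have JE t : t \in `]0, T[ -> J a w t = c * \int[mu]_(s in `]0, T[) G t s.
  rewrite in_itv/= => /andP[t0 tT]; congr (_ * _).
  rewrite (Rintegral_below _ _ (ltW tT)); apply: eq_Rintegral => s _.
  by rewrite /G mulrA.
have intJ : mu.-integrable `]0, T[ (EFin \o (J a w)).
  have := @integrable_scale _ _ _ mu _ c _ (measurable_itv _) intGs.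
  by apply: eq_integrable => // t; rewrite inE/= => tT; rewrite /= JE.
split => //.
pose EG t s := E t * G t s.
have intEG : (mu \x mu)%E.-integrable (`]0, T[ `*` `]0, T[) (fun z => (EG z.1 z.2)%:E).
  apply: (@integrable_mul_bounded _ _ _ (mu \x mu)%E _ (fun z => E z.1)
    (fun z => G z.1 z.2) (expR (n%:R * T))) => //.
  - exact: measurableX.
  - apply: measurable_funTS; apply: measurableT_comp measurable_fst.
    exact: measurable_expR_affine.
  - by move=> [t s] [/= tT _]; exact: EM.
have intEGs := @rect_integrable_Rintegral _ _ _ _ R mu mu _ _ (measurable_itv _)
  (measurable_itv _) EG intEG.
have intEJ : mu.-integrable `]0, T[ (EFin \o (fun t => E t * J a w t)).
  exact: (@integrable_mul_bounded _ _ R mu _ E _ _ (measurable_itv _) mE EM intJ).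
have EJ : \int[mu]_(t in `]0, T[) (E t * J a w t) =
    c * \int[mu]_(t in `]0, T[) \int[mu]_(s in `]0, T[) EG t s.
  rewrite -RintegralZl//; apply: ae_eq_Rintegral => //.
    by apply/measurable_EFinP; apply: measurable_int (integrable_scale _ _ intEGs).
  have aeG := @rect_ae_integrable _ _ _ _ R mu mu _ _ (measurable_itv _)
    (measurable_itv _) G intG.
  apply: ae_imp aeG => t Gt tT.
  by rewrite JE// /EG RintegralZl ?Gt// mulrCA.
change (`|\int[mu]_(t in `]0, T[) (E t * J a w t) -
  c * ka * \int[mu]_(t in `]0, T[) (E t * w t)| <= c * K * \int[mu]_(t in `]0, T[) `|w t|).
rewrite EJ (@rect_fubini _ _ _ _ R mu mu _ _ (measurable_itv _)
  (measurable_itv _) EG intEG).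
pose B s := \int[mu]_(t in `]0, T[)
  ((s < t)%R%:R * (expR (n%:R * (T - t)) * (t - s) `^ (a - 1))).
have BE s : s \in `]0, T[ -> \int[mu]_(t in `]0, T[) EG t s = B s * w s.
  rewrite in_itv/= => sT; have [intB _] := shifted_kernel_truncation n G0 sT.
  rewrite -RintegralZr//; apply: eq_Rintegral => t _.
  by rewrite /EG /G /E; ring.
have intBw : mu.-integrable `]0, T[ (EFin \o (fun s => B s * w s)).
  have := @rect_integrable_Rintegral _ _ _ _ R mu mu _ _ (measurable_itv _)
    (measurable_itv _) (fun s t => EG t s) (@rect_integrable_swap _ _ _ _ R mu mu _ _
    (measurable_itv _) (measurable_itv _) EG intEG).
  by apply: eq_integrable => // s; rewrite inE/= => sT; rewrite BE.
have intEw : mu.-integrable `]0, T[ (EFin \o (fun s => E s * w s)).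
  exact: (@integrable_mul_bounded _ _ R mu _ E _ _ (measurable_itv _) mE EM intw).
have -> : \int[mu]_(s in `]0, T[) (\int[mu]_(t in `]0, T[) EG t s) =
    \int[mu]_(s in `]0, T[) (B s * w s).
  by apply: eq_Rintegral => s; rewrite inE/= => sT; rewrite BE.
rewrite -!mulrA -mulrBr normrM ger0_norm// ler_wpM2l//.
have intkEw := @integrable_scale _ _ _ mu _ ka _ (measurable_itv _) intEw.
rewrite -[ka * _]RintegralZl// -RintegralB//.
have intD := @integrableB _ _ R mu _ (measurable_itv _) _ _ intBw intkEw.
have intnw : mu.-integrable `]0, T[ (EFin \o (fun t => `|w t|)) by exact: integrable_norm.
rewrite (le_trans (le_normr_Rintegral _ _))//.
rewrite -RintegralZl//; apply: le_Rintegral => //.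
- exact: integrable_norm.
- exact: integrable_scale.
- move=> s sT; rewrite mulrA -mulrBl normrM ler_wpM2r//.
  by have [_] := @shifted_kernel_truncation a T s n G0 sT.
Qed.

End fractional_integral.

Section kernel_lower_bound.
Context {R : realType}.
Notation mu := (@lebesgue_measure R).

(** On [0 < r < T / (n + 1)] the exponential is at least [expR (- T)], and the
    kernel is nonincreasing. *)
Lemma fractional_kernel_moment_ge (a T : R) n : Gamma a != 0 -> 0 < T -> a < 1 ->
  (T `^ (1 - a))^-1 * expR (- T) * T / n.+1%:R <=
  \int[mu]_(r in `]0, T[) (expR (- (n%:R * r)) * r `^ (a - 1)).
Proof.
move=> G0 T0 a1; set m := _ * expR (- T); pose h := T / n.+1%:R.
have h0 : 0 < h by rewrite divr_gt0.
have hT : h <= T by rewrite ler_pdivrMr// ler_peMr ?ler1n// ltW.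
have -> : m * T / n.+1%:R = \int[mu]_(r in `]0, T[) ((r < h)%R%:R * m).
  rewrite -(Rintegral_below _ _ hT) Rintegral_cst//= lebesgue_measure_itv/= lte_fin h0/=.
  by rewrite -mulrA subr0.
have intk := fractional_kernel_integrable T G0.
apply: le_Rintegral => //.
- apply: integrable_mul_bool => //; first exact: measurable_fun_ltr.
  apply: measurable_bounded_integrable => //; first exact: lebesgue_oo_lty.
  by exists `|m|; split => // y /ltW my x _; exact: my.
- apply: (integrable_mul_bounded (M := 1)) => //.
    have := @measurable_expR_affine R `]0, T[ n%:R 0.
    by apply: eq_measurable_fun => r _; rewrite sub0r mulrN.
  move=> r; rewrite /= in_itv/= => /andP[r0 rT].
  by rewrite ger0_norm ?expR_ge0// expR_le1 oppr_le0 mulr_ge0// ltW.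
- move=> r; rewrite /= in_itv/= => /andP[r0 rT].
  have [rh|_] := ltP r h; last by rewrite mul0r mulr_ge0 ?expR_ge0 ?powR_ge0.
  rewrite mul1r /m mulrC; apply: ler_pM; rewrite ?expR_ge0 ?invr_ge0 ?powR_ge0//.
    rewrite ler_expR lerN2 (@le_trans _ _ (n%:R * h))//.
      by rewrite ler_wpM2l// ltW.
    by rewrite /h mulrA ler_pdivrMr// mulrC ler_wpM2l ?ltW// ltr_nat.
  have -> : a - 1 = - (1 - a) by ring.
  rewrite powRN lef_pV2 ?posrE ?powR_gt0//.
  by apply: ge0_ler_powR; rewrite ?nnegrE ?subr_ge0 ltW.
Qed.

End kernel_lower_bound.

(** * A Gronwall inequality for double primitives *)

Section second_order_gronwall.
Context {R : realType}.
Notation mu := (@lebesgue_measure R).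
Implicit Types (q r z h : R -> R).

Lemma ae_le_Rintegral (D : set R) (f g : R -> R) : measurable D ->
  mu.-integrable D (EFin \o f) -> mu.-integrable D (EFin \o g) ->
  (forall x, D x -> 0 <= f x) -> (forall x, D x -> 0 <= g x) ->
  (\forall x \ae mu, D x -> f x <= g x) ->
  \int[mu]_(x in D) f x <= \int[mu]_(x in D) g x.
Proof.
move=> mD intf intg f0 g0 fg; apply: fine_le.
- exact: integrable_fin_num.
- exact: integrable_fin_num.
- apply: ae_ge0_le_integral => //.
  + exact: measurable_int intf.
  + exact: measurable_int intg.
Qed.

Lemma Rintegral_expR_le (m y : R) : 0 < m -> 0 < y ->
  \int[mu]_(x in `]0, y[) expR (m * x) <= expR (m * y) / m.
Proof.
move=> m0 y0; pose F (x : R) := expR (m * x) / m.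
have dm (x : R) : is_derive x 1 (fun y : R => m * y) m.
  by apply: (is_derive_eq (is_deriveZ m (is_derive_id x 1))); rewrite /GRing.scale/= mulr1.
have dF (x : R) : is_derive x 1 F (expR (m * x)).
  have de := is_derive1_comp (is_derive_expR (m * x)) (dm x).
  have := is_deriveZ m^-1 de.
  have -> : m^-1 \*: (expR \o (fun y : R => m * y)) = F.
    by apply/funext => z; rewrite /F [RHS]mulrC.
  by move=> h; apply: (is_derive_eq h); rewrite /GRing.scale/= mulrCA mulVf ?mulr1// gt_eqF.
have derF x : derivable F x 1 by case: (dF x).
have cF := derivable_continuous derF.
have ce : continuous (fun x : R => expR (m * x)).
  move=> x; apply: continuous_comp; last exact: continuous_expR.
  by apply: cvgM; [exact: cvg_cst|exact: cvg_id].
rewrite /Rintegral -(integral_itv_bndoo true false); last first.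
  by apply/measurable_EFinP; apply: measurable_funTS; exact: continuous_measurable_fun.
rewrite (continuous_FTC2 y0 (F := F)).
- by rewrite /= /F lerBlDr lerDl mulr0 expR0 mul1r invr_ge0 ltW.
- exact: continuous_subspaceT.
- by split => [x _||]; [exact: derF|exact/cvg_at_right_filter/cF|exact/cvg_at_left_filter/cF].
- by move=> x _; rewrite derive1E; case: (dF x).
Qed.

Lemma primitive_le h y : mu.-integrable `]0, 1[ (EFin \o h) ->
  (forall x : R, x \in `]0, 1[ -> 0 <= h x) -> y <= 1 ->
  \int[mu]_(x in `]0, y[) h x <= \int[mu]_(x in `]0, 1[) h x.
Proof.
move=> inth h0 y1; rewrite (Rintegral_below _ _ y1); apply: le_Rintegral => //.
  by apply: integrable_mul_bool => //; exact: measurable_fun_ltr.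
by move=> x x01; case: (x < y); rewrite ?mul1r// mul0r; exact: h0.
Qed.

Let prim z x := \int[mu]_(y in `]0, x[) z y.

(** One Picard iteration: integrating [expR (m * x)] twice divides it by
    [m ^+ 2]. *)
Lemma double_primitive_step z h (A B N m : R) :
  mu.-integrable `]0, 1[ (EFin \o z) -> mu.-integrable `]0, 1[ (EFin \o h) ->
  (forall x : R, x \in `]0, 1[ -> 0 <= h x) -> 0 <= A -> 0 <= B -> 0 < m ->
  0 <= N ->
  (\forall x \ae mu, x \in `]0, 1[ -> `|z x| <= A * `|prim (prim z) x| + B * h x) ->
  (forall x : R, x \in `]0, 1[ -> `|prim (prim z) x| <= N * expR (m * x)) ->
  forall x, x \in `]0, 1[ -> `|prim (prim z) x| <=
    (A * N / m ^+ 2 + B * \int[mu]_(x in `]0, 1[) h x) * expR (m * x).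
Proof.
move=> intz inth h0 A0 B0 m0 N0 zle Nle.
set H := \int[mu]_(x in `]0, 1[) h x.
have H0 : 0 <= H by exact: Rintegral_ge0.
have sub (x : R) : x <= 1 -> `]0, x[ `<=` (`]0, 1[ : set R).
  by move=> x1; apply: subset_itvl; rewrite bnd_simp.
have intS x f : x <= 1 -> mu.-integrable `]0, 1[ (EFin \o f) ->
    mu.-integrable `]0, x[ (EFin \o f).
  by move=> x1; apply: integrableS => //; exact: sub.
have intE k x : mu.-integrable `]0, x[ (EFin \o (fun y : R => k * expR (m * y))).
  apply: integrable_scale => //; apply: measurable_bounded_integrable => //.
  - exact: lebesgue_oo_lty.
  - have := @measurable_expR_affine R `]0, x[ (- m) 0.
    by apply: eq_measurable_fun => r _; congr expR; ring.
  - exists (expR (m * x)); split; first exact: num_real.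
    move=> y my t; rewrite /= in_itv/= => /andP[t0 tx].
    rewrite ger0_norm ?expR_ge0// (le_trans _ (ltW my))// ler_expR ler_wpM2l// ltW//.
have int1 : mu.-integrable `]0, 1[ (EFin \o (prim z)) by exact: primitive_integrable.
have first y : y \in `]0, 1[ -> `|prim z y| <= A * N / m * expR (m * y) + B * H.
  move=> y01; have := y01; rewrite in_itv/= => /andP[y0 y1].
  rewrite (le_trans (le_normr_Rintegral _ (intS _ _ (ltW y1) intz)))//.
  have intR : mu.-integrable `]0, y[ (EFin \o (fun x => (A * N) * expR (m * x) + B * h x)).
    have := @integrableD _ _ R mu _ (measurable_itv _) _ _ (intE (A * N) y)
      (@integrable_scale _ _ _ mu _ B _ (measurable_itv _) (intS _ _ (ltW y1) inth)).
    by apply: eq_integrable.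
  apply: (@le_trans _ _ (\int[mu]_(x in `]0, y[) ((A * N) * expR (m * x) + B * h x))).
    apply: ae_le_Rintegral => //.
    - by apply: integrable_norm; exact: intS (ltW y1) intz.
    - move=> x xy; rewrite addr_ge0 ?mulr_ge0 ?expR_ge0//; apply: h0.
      exact: (sub _ (ltW y1) _ xy).
    - apply: ae_imp zle => x zx /(sub _ (ltW y1)) x01; rewrite (le_trans (zx x01))//.
      by rewrite lerD2r -mulrA ler_wpM2l//; exact: Nle.
  rewrite RintegralD//; last first.
    exact: (@integrable_scale _ _ _ mu _ B _ (measurable_itv _) (intS _ _ (ltW y1) inth)).
  rewrite RintegralZl//; last by have := intE 1 y; apply: eq_integrable => // t _ /=; rewrite mul1r.
  rewrite RintegralZl//; last exact: intS (ltW y1) inth.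
  rewrite lerD//; last by rewrite ler_wpM2l//; apply: primitive_le => //; exact: ltW.
  by rewrite -[leRHS]mulrA ler_wpM2l ?mulr_ge0// mulrC Rintegral_expR_le.
move=> x x01; have := x01; rewrite in_itv/= => /andP[x0 x1].
rewrite (le_trans (le_normr_Rintegral _ (intS _ _ (ltW x1) int1)))//.
have intc : mu.-integrable `]0, x[ (EFin \o (fun=> B * H)).
  apply: measurable_bounded_integrable => //; first exact: lebesgue_oo_lty.
  by exists `|B * H|; split => // y /ltW my t _; exact: my.
apply: (@le_trans _ _ (\int[mu]_(y in `]0, x[) (A * N / m * expR (m * y) + B * H))).
  apply: le_Rintegral => //.
  - by apply: integrable_norm; exact: intS (ltW x1) int1.
  - have := @integrableD _ _ R mu _ (measurable_itv _) _ _ (intE (A * N / m) x) intc.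
    by apply: eq_integrable.
  - by move=> y /(sub _ (ltW x1)); exact: first.
rewrite RintegralD// RintegralZl//; last first.
  by have := intE 1 x; apply: eq_integrable => // t _ /=; rewrite mul1r.
rewrite Rintegral_cst//= lebesgue_measure_itv/= lte_fin x0/= subr0 mulrDl lerD//.
  have -> : A * N / m ^+ 2 * expR (m * x) = A * N / m * (expR (m * x) / m).
    by field; rewrite gt_eqF.
  by rewrite ler_wpM2l ?Rintegral_expR_le// divr_ge0 ?mulr_ge0// ltW.
rewrite ler_wpM2l ?mulr_ge0// (le_trans (ltW x1))//.
by rewrite -[leLHS]expR0 ler_expR mulr_ge0 ?ltW.
Qed.

(** With [2 * A <= m ^+ 2] each Picard iteration halves the constant in front of
    [expR (m * x)], up to a fixed contribution of [h].  The exceptional null set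
    is where [q] differs from the double primitive of [z], so it does not depend
    on [m]. *)
Lemma double_primitive_gronwall q r z h (A B : R) :
  mu.-integrable `]0, 1[ (EFin \o z) -> mu.-integrable `]0, 1[ (EFin \o h) ->
  mu.-integrable `]0, 1[ (EFin \o r) ->
  (forall x : R, x \in `]0, 1[ -> 0 <= h x) -> 0 <= A -> 0 <= B ->
  (\forall x \ae mu, x \in `]0, 1[ -> q x = prim r x) ->
  (\forall x \ae mu, x \in `]0, 1[ -> r x = prim z x) ->
  (\forall x \ae mu, x \in `]0, 1[ -> `|z x| <= A * `|q x| + B * h x) ->
  \forall x \ae mu, x \in `]0, 1[ -> forall m, 0 < m -> 2 * A <= m ^+ 2 ->
    `|q x| <= 2 * B * (\int[mu]_(x in `]0, 1[) h x) * expR m.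
Proof.
move=> intz inth intr h0 A0 B0 qr rz zle.
set H := \int[mu]_(x in `]0, 1[) h x.
have H0 : 0 <= H by exact: Rintegral_ge0.
pose Q := prim (prim z).
have intpz : mu.-integrable `]0, 1[ (EFin \o (prim z)) by exact: primitive_integrable.
have qQ : \forall x \ae mu, x \in `]0, 1[ -> q x = Q x.
  apply: ae_imp qr => x qx x01; rewrite qx//.
  move: x01; rewrite in_itv/= => /andP[_ x1].
  have sub : `]0, x[ `<=` `]0, 1[ by apply: subset_itvl; rewrite bnd_simp ltW.
  have intpx : mu.-integrable `]0, x[ (EFin \o prim z) by exact: integrableS intpz.
  apply: ae_eq_Rintegral => //; first exact: integrableS intr.
    by apply/measurable_EFinP; exact: measurable_int intpx.
  by apply: ae_imp rz => y ry /sub; exact: ry.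
have zle' : \forall x \ae mu, x \in `]0, 1[ -> `|z x| <= A * `|Q x| + B * h x.
  by apply: ae_imp2 qQ zle => x qx zx x01; rewrite -qx// zx.
apply: ae_imp qQ => x qx x01 m m0 mA; rewrite {}qx//.
(* A crude bound starts the iteration; its share of the constant is halved k times. *)
pose Z := \int[mu]_(x in `]0, 1[) `|z x|.
have Z0 : 0 <= Z by exact: Rintegral_ge0.
have QZ y : y \in `]0, 1[ -> `|Q y| <= Z * expR (m * y).
  rewrite in_itv/= => /andP[y0 y1].
  have sub : `]0, y[ `<=` `]0, 1[ by apply: subset_itvl; rewrite bnd_simp ltW.
  have primZ t : t \in `]0, 1[ -> `|prim z t| <= Z.
    rewrite in_itv/= => /andP[t0 t1].
    rewrite (le_trans (le_normr_Rintegral _ _))//.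
      by apply: integrableS intz => //; apply: subset_itvl; rewrite bnd_simp ltW.
    by apply: primitive_le; [exact: integrable_norm|by []|exact: ltW].
  have intpy : mu.-integrable `]0, y[ (EFin \o prim z) by exact: integrableS intpz.
  rewrite (le_trans (le_normr_Rintegral _ intpy))//.
  apply: (@le_trans _ _ (\int[mu]_(t in `]0, y[) Z)).
    apply: le_Rintegral => //.
    - exact: integrable_norm.
    - apply: measurable_bounded_integrable => //; first exact: lebesgue_oo_lty.
      by exists `|Z|; split => // b /ltW Zb t _; exact: Zb.
    - by move=> t /sub; exact: primZ.
  rewrite Rintegral_cst//= lebesgue_measure_itv/= lte_fin y0/= subr0.
  rewrite ler_wpM2l// (le_trans (ltW y1))//.
  by rewrite -[leLHS]expR0 ler_expR mulr_ge0 ?ltW.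
have Qb k y : y \in `]0, 1[ -> `|Q y| <= (2 * B * H + Z / 2 ^+ k) * expR (m * y).
  elim: k y => [|k IH] y y01.
    rewrite expr0 divr1 (le_trans (QZ _ y01))// ler_wpM2r ?expR_ge0// lerDr.
    by rewrite !mulr_ge0.
  have N0 : 0 <= 2 * B * H + Z / 2 ^+ k.
    by rewrite addr_ge0 ?mulr_ge0// divr_ge0// exprn_ge0.
  rewrite (le_trans (double_primitive_step intz inth h0 A0 B0 m0 N0 zle' IH y01))//.
  rewrite ler_wpM2r ?expR_ge0// -/H.
  set N := 2 * B * H + Z / 2 ^+ k in N0 *.
  have -> : 2 * B * H + Z / 2 ^+ k.+1 = N / 2 + B * H.
    by rewrite /N exprS invfM; field; rewrite ?expf_neq0.
  rewrite lerD2r ler_pdivrMr ?exprn_gt0// mulrC.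
  have -> : N / 2 * m ^+ 2 = N * (m ^+ 2 / 2) by ring.
  by rewrite ler_wpM2l// ler_pdivlMr// mulrC.
have x1 : expR (m * x) <= expR m.
  by move: x01; rewrite in_itv/= => /andP[_ /ltW x1]; rewrite ler_expR ler_piMr// ltW.
have BH0 : 0 <= 2 * B * H by rewrite !mulr_ge0.
have cvk : (2 * B * H + Z / 2 ^+ k) * expR (m * x) @[k --> \oo] -->
    (2 * B * H + Z * 0) * expR (m * x).
  apply: cvgMl; apply: cvgD; first exact: cvg_cst.
  apply: cvgMr; under eq_fun do rewrite -exprVn.
  by apply: cvg_expr; rewrite ger0_norm ?invr_ge0// invf_lt1// ltr1n.
rewrite mulr0 addr0 in cvk.
apply: (@le_trans _ _ (2 * B * H * expR (m * x))); last by rewrite ler_wpM2l.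
rewrite -(cvg_lim _ cvk)//; apply: limr_ge; first by apply: cvgP; exact: cvk.
by apply: nearW => k; exact: Qb.
Qed.

End second_order_gronwall.

(** * Null sets of products, and primitives of moments *)

Section product_null_sets.
Context d1 d2 (T1 : measurableType d1) (T2 : measurableType d2) (R : realType).
Variable m1 : {sigma_finite_measure set T1 -> \bar R}.
Variable m2 : {sigma_finite_measure set T2 -> \bar R}.
Variables (A : set T1) (B : set T2).
Hypotheses (mA : measurable A) (mB : measurable B).

Lemma ae_prod_iterated (P : T1 * T2 -> Prop) :
  (\forall z \ae (m1 \x m2)%E, (A `*` B) z -> P z) ->
  \forall x \ae m1, A x -> \forall y \ae m2, B y -> P (x, y).
Proof.
move=> [N [mN N0 subN]].
have mx := measurable_fun_xsection m2 mN.
have : (\int[m1]_x `|m2 (xsection N x)|)%E = 0%E.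
  by rewrite -[RHS]N0; apply: eq_integral => x _; rewrite gee0_abs.
move=> /(ae_eq_integral_abs m1 measurableT mx).
apply: ae_imp => x /= /(_ I) N0x Ax.
exists (xsection N x); split => //; first exact: measurable_xsection.
move=> y /= nP; rewrite /xsection/= inE; apply: subN => /= h; apply: nP => By.
exact: h.
Qed.

(** Fubini's theorem for the integral of [`|f|]. *)
Lemma ae_iterated_prod_eq0 (f : T1 -> T2 -> R) :
  (m1 \x m2)%E.-integrable (A `*` B) (fun z => (f z.1 z.2)%:E) ->
  (\forall x \ae m1, A x -> \forall y \ae m2, B y -> f x y = 0) ->
  \forall z \ae (m1 \x m2)%E, (A `*` B) z -> f z.1 z.2 = 0.
Proof.
move=> intf f0; have mAB := measurableX mA mB.
have intnf : (m1 \x m2)%E.-integrable (A `*` B) (fun z => (`|f z.1 z.2|)%:E).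
  exact: (@integrable_norm _ _ _ (m1 \x m2)%E _ (fun z => f z.1 z.2)).
have := rect_fubini1 mA mB (f := fun x y => `|f x y|) intnf.
have -> : \int[m1]_(x in A) \int[m2]_(y in B) `|f x y| = 0.
  rewrite -[RHS](_ : \int[m1]_(x in A) 0 = 0); last first.
    by rewrite /Rintegral integral0.
  congr fine; apply: ae_eq_integral => //.
    by have /integrableP[] := rect_integrable_Rintegral mA mB (f := fun x y => `|f x y|) intnf.
  apply: ae_imp2 f0 (rect_ae_integrable mA mB intf) => x fx0 intx Ax.
  congr EFin; rewrite -[RHS](_ : \int[m2]_(y in B) 0 = 0); last first.
    by rewrite /Rintegral integral0.
  congr fine; apply: ae_eq_integral => //.
    by have /integrableP[] := integrable_norm (intx Ax).
  by apply: ae_imp (fx0 Ax) => y fy By; rewrite fy// normr0.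
move=> /esym int0.
have : (\int[m1 \x m2]_(z in A `*` B) `|(f z.1 z.2)%:E| = 0)%E.
  rewrite -[LHS]fineK; first by congr EFin; exact: int0.
  exact: (integrable_fin_num mAB intnf).
move=> /(ae_eq_integral_abs (m1 \x m2)%E mAB (measurable_int _ intf)).
by apply: ae_imp => z fz /fz [].
Qed.

End product_null_sets.

Section weighted_fubini.
Context d1 d2 (T1 : measurableType d1) (T2 : measurableType d2) (R : realType).
Variable m1 : {sigma_finite_measure set T1 -> \bar R}.
Variable m2 : {sigma_finite_measure set T2 -> \bar R}.
Variables (A : set T1) (B : set T2).
Hypotheses (mA : measurable A) (mB : measurable B).
Variables (f : T1 -> T2 -> R) (g : T1 -> R) (phi : T2 -> R) (Mg Mphi : R).
Hypotheses (intf : (m1 \x m2)%E.-integrable (A `*` B) (fun z => (f z.1 z.2)%:E))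
  (mg : measurable_fun A g) (gM : forall x, A x -> `|g x| <= Mg)
  (mphi : measurable_fun B phi) (phiM : forall y, B y -> `|phi y| <= Mphi).

Lemma rect_integrable_mul2 :
  (m1 \x m2)%E.-integrable (A `*` B) (fun z => (phi z.2 * f z.1 z.2)%:E).
Proof.
apply: (@integrable_mul_bounded _ _ _ (m1 \x m2)%E _ (fun z => phi z.2)
    (fun z => f z.1 z.2) Mphi) => //; first exact: measurableX.
  apply: (measurable_comp mB _ mphi); last exact: measurable_funTS measurable_snd.
  by move=> _ [[x y] [_ By] <-].
by move=> [x y] [_ By]; exact: phiM.
Qed.

Lemma weighted_fubini :
  \int[m1]_(x in A) (g x * \int[m2]_(y in B) (phi y * f x y)) =
  \int[m2]_(y in B) (phi y * \int[m1]_(x in A) (g x * f x y)).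
Proof.
have intpf := rect_integrable_mul2.
have mg1 : measurable_fun (A `*` B) (fun z => g z.1).
  apply: (measurable_comp mA _ mg); last exact: measurable_funTS measurable_fst.
  by move=> _ [[x y] [Ax _] <-].
have gM1 z : (A `*` B) z -> `|g z.1| <= Mg by move=> [Az _]; exact: gM.
have mAB := measurableX mA mB.
have intgf : (m1 \x m2)%E.-integrable (A `*` B) (fun z => (g z.1 * f z.1 z.2)%:E).
  exact: (@integrable_mul_bounded _ _ _ (m1 \x m2)%E _ (fun z => g z.1)
    (fun z => f z.1 z.2) Mg mAB mg1 gM1 intf).
pose P x y := g x * (phi y * f x y).
have intP : (m1 \x m2)%E.-integrable (A `*` B) (fun z => (P z.1 z.2)%:E).
  exact: (@integrable_mul_bounded _ _ _ (m1 \x m2)%E _ (fun z => g z.1)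
    (fun z => phi z.2 * f z.1 z.2) Mg mAB mg1 gM1 intpf).
transitivity (\int[m1]_(x in A) \int[m2]_(y in B) P x y).
  apply/esym; apply: ae_eq_Rintegral => //.
  - exact: rect_integrable_Rintegral intP.
  - apply: measurable_funM => //; apply/measurable_EFinP.
    exact: measurable_int (rect_integrable_Rintegral mA mB (f := fun x y => phi y * f x y) intpf).
  - apply: ae_imp (rect_ae_integrable mA mB (f := fun x y => phi y * f x y) intpf).
    by move=> x intx Ax; rewrite RintegralZl//; exact: intx.
rewrite (rect_fubini mA mB intP); apply: ae_eq_Rintegral => //.
- exact: (rect_integrable_Rintegral mB mA (f := fun y x => P x y)
    (rect_integrable_swap mA mB intP)).
- apply: measurable_funM => //; apply/measurable_EFinP.
  exact: measurable_int (rect_integrable_Rintegral mB mA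
    (f := fun y x => g x * f x y) (rect_integrable_swap mA mB
      (f := fun x y => g x * f x y) intgf)).
- apply: ae_imp (rect_ae_integrable mB mA (f := fun y x => g x * f x y)
    (rect_integrable_swap mA mB (f := fun x y => g x * f x y) intgf)).
  move=> y inty By; rewrite -RintegralZl//; last exact: inty.
  by apply: eq_Rintegral => x _; rewrite /P mulrCA.
Qed.

End weighted_fubini.

Section weighted_primitives.
Context {R : realType}.
Notation mu := (@lebesgue_measure R).

Lemma Rintegral_indic (D E : set R) (F : R -> R) : E `<=` D ->
  \int[mu]_(x in E) F x = \int[mu]_(x in D) (\1_E x * F x).
Proof.
move=> ED; rewrite [LHS]Rintegral_mkcond [RHS]Rintegral_mkcond.
apply: eq_Rintegral => x _; rewrite !patchE indicE.
have [xE|xE] := boolP (x \in E); last by rewrite mul0r if_same.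
by rewrite mul1r mem_set//; apply: ED; exact: set_mem.
Qed.

Lemma tail_integral_measurable_le1 (g : R -> R) : measurable_fun (`]0, 1[ : set R) g ->
  (forall x : R, x \in `]0, 1[ -> `|g x| <= 1) ->
  measurable_fun (`]0, 1[ : set R) (fun y : R => \int[mu]_(x in `]y, 1[) g x) /\
  forall y : R, y \in `]0, 1[ -> `|\int[mu]_(x in `]y, 1[) g x| <= 1.
Proof.
move=> mg g1.
have int1 b : mu.-integrable `]b, 1[ (EFin \o (fun=> 1 : R)).
  apply: measurable_bounded_integrable => //; first exact: lebesgue_oo_lty.
  by exists 1; split => // M /ltW M1 x _; rewrite normr1.
have intg : mu.-integrable `]0, 1[ (EFin \o g).
  apply: measurable_bounded_integrable => //; first exact: lebesgue_oo_lty.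
  by exists 1; split => // M /ltW M1 x /= x01; rewrite (le_trans (g1 _ x01)).
split.
  have intK : (mu \x mu)%E.-integrable (`]0, 1[ `*` `]0, 1[)
      (fun z => ((z.1 < z.2)%R%:R * g z.2)%:E).
    apply: (@integrable_kernel _ _ _ _ R mu mu _ _ (fun y x => (y < x)%R%:R) g 1) => //.
    - exact: lebesgue_oo_lty.
    - apply: measurable_funTS.
      apply: (@measurable_bool_natr _ _ R setT
        (fun z : measurableTypeR R * measurableTypeR R => z.1 < z.2)).
      by apply: measurable_fun_ltr; [exact: measurable_fst|exact: measurable_snd].
    - by move=> y x _ _; rewrite normr_nat lern1; case: (_ < _).
  have /integrableP[/measurable_EFinP + _] := @rect_integrable_Rintegral _ _ _ _ R mu mu _ _
    (measurable_itv _) (measurable_itv _) (fun y x => (y < x)%R%:R * g x) intK.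
  apply: eq_measurable_fun => y; rewrite inE/= in_itv/= => /andP[y0 _].
  by rewrite (Rintegral_above _ _ (ltW y0)).
move=> y; rewrite in_itv/= => /andP[y0 y1].
have sub : `]y, 1[ `<=` (`]0, 1[ : set R).
  by apply: subset_itvr; rewrite bnd_simp ltW.
have intgy : mu.-integrable `]y, 1[ (EFin \o g) by exact: integrableS intg.
rewrite (le_trans (le_normr_Rintegral _ intgy))//.
apply: (@le_trans _ _ (\int[mu]_(x in `]y, 1[) 1)).
  apply: le_Rintegral => //; first exact: integrable_norm.
  by move=> x /sub; exact: g1.
rewrite Rintegral_cst//= lebesgue_measure_itv/= lte_fin y1/= mul1r.
by rewrite lerBlDr lerDl ltW.
Qed.

(** Both sides are tested on an arbitrary measurable set [E].  Fubini moves the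
    integral in [t] outside, the identity is used for fixed [t] with the
    indicator of [E] as a weight, and the triangle formula exchanges the
    primitive and the weight. *)
Lemma weighted_primitive (T : R) (f h : R -> R -> R) (phi : R -> R) (M : R) :
  (mu \x mu)%E.-integrable (cyl T) (fun z => (f z.1 z.2)%:E) ->
  (mu \x mu)%E.-integrable (cyl T) (fun z => (h z.1 z.2)%:E) ->
  measurable_fun `]0, T[ phi ->
  (forall t : R, t \in `]0, T[ -> `|phi t| <= M) ->
  (\forall t \ae mu, t \in `]0, T[ ->
    \forall x \ae mu, x \in `]0, 1[ -> f x t = \int[mu]_(y in `]0, x[) h y t) ->
  \forall x \ae mu, x \in `]0, 1[ ->
    \int[mu]_(t in `]0, T[) (phi t * f x t) =
    \int[mu]_(y in `]0, x[) \int[mu]_(t in `]0, T[) (phi t * h y t).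
Proof.
move=> intf inth mphi phiM fh.
have mI : measurable (`]0, 1[ : set (measurableTypeR R)) by exact: measurable_itv.
have mT : measurable (`]0, T[ : set (measurableTypeR R)) by exact: measurable_itv.
pose hat (k : R -> R -> R) x := \int[mu]_(t in `]0, T[) (phi t * k x t).
have int_hat k : (mu \x mu)%E.-integrable (cyl T) (fun z => (k z.1 z.2)%:E) ->
    mu.-integrable `]0, 1[ (EFin \o (hat k)).
  move=> intk.
  exact: (rect_integrable_Rintegral mI mT (f := fun x t => phi t * k x t)
    (@rect_integrable_mul2 _ _ _ _ R mu mu _ _ mI mT k phi M intk mphi phiM)).
have intp := primitive_integrable (int_hat _ inth).
have intfhat := int_hat _ intf.
suff : ae_eq mu `]0, 1[%classic (EFin \o (hat f))
    (EFin \o (fun x => \int[mu]_(y in `]0, x[) hat h y)).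
  by apply: ae_imp => x fx /fx [].
apply: (@integral_ae_eq _ _ R mu _ mI _ _ intfhat (measurable_int _ intp)).
move=> E sE mE.
have intE k : mu.-integrable `]0, 1[ (EFin \o k) -> mu.-integrable E (EFin \o k).
  exact: integrableS.
rewrite -[LHS]fineK; last by apply: integrable_fin_num => //; exact: intE.
rewrite -[RHS]fineK; last by apply: integrable_fin_num => //; exact: intE.
congr EFin; change (\int[mu]_(x in E) hat f x =
  \int[mu]_(x in E) \int[mu]_(y in `]0, x[) hat h y).
rewrite (Rintegral_indic _ sE) [RHS](Rintegral_indic _ sE).
have mg : measurable_fun (`]0, 1[ : set R) (\1_E : R -> R) by exact: measurable_indic.
have g1 (x : R) : x \in `]0, 1[ -> `|\1_E x : R| <= 1.
  by move=> _; rewrite indicE; case: (_ \in _); rewrite ?normr1 ?normr0.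
(* The weight that the primitive transfers from the indicator to h. *)
have [mk k1] := tail_integral_measurable_le1 mg g1.
rewrite (triangle_fubini mg g1 (int_hat _ inth)).
rewrite (@weighted_fubini _ _ _ _ R mu mu _ _ mI mT f _ phi 1 M intf mg g1 mphi phiM).
rewrite (@weighted_fubini _ _ _ _ R mu mu _ _ mI mT h _ phi 1 M inth mk k1 mphi phiM).
have int_slice (b : R -> R) (N : R) (k : R -> R -> R) :
    measurable_fun (`]0, 1[ : set R) b -> (forall x : R, x \in `]0, 1[ -> `|b x| <= N) ->
    (mu \x mu)%E.-integrable (cyl T) (fun z => (k z.1 z.2)%:E) ->
    mu.-integrable `]0, T[
      (EFin \o (fun t => phi t * \int[mu]_(x in `]0, 1[) (b x * k x t))).
  move=> mb bN intk; apply: (@integrable_mul_bounded _ _ R mu _ phi _ M mT mphi phiM).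
  exact: (rect_integrable_Rintegral mT mI (f := fun t x => b x * k x t)
    (@rect_integrable_mul2 _ _ _ _ R mu mu _ _ mT mI (fun t x => k x t) b N
      (rect_integrable_swap mI mT intk) mb bN)).
apply: ae_eq_Rintegral => //.
- exact: int_slice mg g1 intf.
- by apply/measurable_EFinP; exact: measurable_int (int_slice _ _ _ mk k1 inth).
have aef := @rect_ae_integrable _ _ _ _ R mu mu _ _ mT mI (fun t x => f x t)
  (rect_integrable_swap mI mT intf).
have aeh := @rect_ae_integrable _ _ _ _ R mu mu _ _ mT mI (fun t x => h x t)
  (rect_integrable_swap mI mT inth).
apply: ae_imp2 (ae_imp2 _ fh aef) aeh => [t pt iht tT|t H1 H2]; last exact: (conj H1 H2).
have [fht ift] := pt; have {}fht := fht tT; have {}ift := ift tT; have {}iht := iht tT.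
congr (_ * _); rewrite -(triangle_fubini mg g1 iht); apply: ae_eq_Rintegral => //.
- exact: (@integrable_mul_bounded _ _ R mu _ _ _ 1 mI mg g1 ift).
- apply: measurable_funM => //; apply/measurable_EFinP.
  exact: measurable_int (primitive_integrable iht).
- by apply: ae_imp fht => x fx x01; rewrite fx.
Qed.

End weighted_primitives.

(** * The differential inequality in space *)

Section sideways_estimate.
Context {R : realType}.
Notation mu := (@lebesgue_measure R).

Definition exp_moment (T : R) (n : nat) (f : R -> R) : R :=
  \int[mu]_(t in `]0, T[) (expR (n%:R * (T - t)) * f t).

Definition kernel_mass (a T : R) : R :=
  (Gamma a)^-1 * \int[mu]_(r in `]0, T[) (r `^ (a - 1)).

(** A constant [L] such that [L * (n + 1)] bounds the symbol of the fractional
    derivative at frequency [n].  The true order is [n `^ a], but linear growth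
    is enough since two derivatives in space correspond to its square root. *)
Definition inverse_symbol (a T : R) : R :=
  ((Gamma a)^-1 * ((T `^ (1 - a))^-1 * expR (- T) * T))^-1.

Lemma Gamma_ge0 (a : R) : 0 <= Gamma a.
Proof.
by apply: Rintegral_ge0 => r _; rewrite mulr_ge0 ?powR_ge0 ?expR_ge0.
Qed.

Lemma inverse_symbol_gt0 (a T : R) : Gamma a != 0 -> 0 < T -> 0 < inverse_symbol a T.
Proof.
move=> G0 T0; have c0 : 0 < Gamma a by rewrite lt_neqAle Gamma_ge0 eq_sym G0.
by rewrite invr_gt0 !mulr_gt0 ?invr_gt0 ?powR_gt0 ?expR_gt0.
Qed.

(** [fractional_laplace] is solved for the moment of the fractional derivative
    [W], which the equation relates to those of [U] and [V]. *)
Lemma slice_estimate (a T p Mp : R) (U V W : R -> R) (n : nat) :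
  Gamma a != 0 -> 0 < T -> a < 1 -> `|p| <= Mp ->
  mu.-integrable `]0, T[ (EFin \o U) -> mu.-integrable `]0, T[ (EFin \o V) ->
  mu.-integrable `]0, T[ (EFin \o W) ->
  (\forall t \ae mu, t \in `]0, T[ -> J a W t = U t) ->
  (\forall t \ae mu, t \in `]0, T[ -> W t = V t + p * U t) ->
  `|exp_moment T n V| <=
    (inverse_symbol a T * n.+1%:R + Mp) * `|exp_moment T n U| +
    inverse_symbol a T * n.+1%:R * kernel_mass a T * \int[mu]_(t in `]0, T[) `|W t|.
Proof.
move=> G0 T0 a1 pM intU intV intW JU WE.
set K := kernel_mass a T; pose hat := exp_moment T n; rewrite -/hat.
pose E (t : R) := expR (n%:R * (T - t)).
have mE : measurable_fun (`]0, T[ : set R) E by exact: measurable_expR_affine.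
have EM (t : R) : t \in `]0, T[ -> `|E t| <= expR (n%:R * T).
  exact: norm_expR_affine_le.
have int_E f : mu.-integrable `]0, T[ (EFin \o f) ->
    mu.-integrable `]0, T[ (EFin \o (fun t => E t * f t)).
  move=> intf.
  exact: (@integrable_mul_bounded _ _ R mu _ E _ _ (measurable_itv _) mE EM intf).
have [intJ] := fractional_laplace n G0 intW.
have -> : \int[mu]_(t in `]0, T[) (expR (n%:R * (T - t)) * J a W t) = hat U.
  apply: ae_eq_Rintegral => //; first exact: int_E.
    by apply/measurable_EFinP; exact: measurable_int (int_E _ intU).
  by apply: ae_imp JU => t JUt tT; rewrite JUt.
rewrite -/(exp_moment T n W) -/hat -/(kernel_mass a T) -/K; set ka := \int[mu]_(r in _) _ => bound.
have WVU : hat W = hat V + p * hat U.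
  have intpU : mu.-integrable `]0, T[ (EFin \o (fun t => p * (E t * U t))).
    exact: (@integrable_scale _ _ _ mu _ _ _ (measurable_itv _) (int_E _ intU)).
  rewrite /hat /exp_moment -RintegralZl//; last exact: int_E.
  rewrite -RintegralD//; last exact: int_E.
  apply: ae_eq_Rintegral => //; first exact: int_E.
    have := @integrableD _ _ R mu _ (measurable_itv _) _ _ (int_E _ intV) intpU.
    by move=> h; apply/measurable_EFinP; exact: measurable_int h.
  by apply: ae_imp WE => t WEt tT; rewrite WEt//; ring.
have c0 : 0 < (Gamma a)^-1 by rewrite invr_gt0 lt_neqAle Gamma_ge0 eq_sym G0.
have L0 := inverse_symbol_gt0 G0 T0.
set L := inverse_symbol a T in L0 *.
set N := \int[mu]_(t in _) _ in bound *.
have kaL : 1 <= L * n.+1%:R * ((Gamma a)^-1 * ka).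
  have kage := fractional_kernel_moment_ge n G0 T0 a1; rewrite -/ka in kage.
  set m := _ * T in kage.
  have m0 : 0 < m by rewrite !mulr_gt0 ?invr_gt0 ?powR_gt0 ?expR_gt0.
  have LE : L = ((Gamma a)^-1 * m)^-1 by [].
  have -> : (1 <= L * n.+1%:R * ((Gamma a)^-1 * ka)) =
      (L * n.+1%:R * ((Gamma a)^-1 * (m / n.+1%:R)) <= L * n.+1%:R * ((Gamma a)^-1 * ka)).
    congr (_ <= _).
    rewrite LE; field.
    by apply/and3P; split; rewrite // ?lt0r_neq0// nat1r.
  apply: ler_wpM2l; first by rewrite mulr_ge0// ltW.
  by apply: ler_wpM2l => //; exact: ltW.
have hW : `|hat W| <= L * n.+1%:R * (`|hat U| + K * N).
  have Ln0 : 0 <= L * n.+1%:R by rewrite mulr_ge0// ltW.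
  have ka0 : 0 <= (Gamma a)^-1 * ka.
    rewrite mulr_ge0 ?(ltW c0)//; apply: Rintegral_ge0 => r _.
    by rewrite mulr_ge0 ?expR_ge0 ?powR_ge0.
  have h1 : (Gamma a)^-1 * ka * `|hat W| <= `|hat U| + K * N.
    rewrite -[X in X * _]ger0_norm// -normrM.
    have -> : (Gamma a)^-1 * ka * hat W = hat U - (hat U - (Gamma a)^-1 * ka * hat W) by ring.
    by rewrite (le_trans (ler_normB _ _))// lerD2l.
  apply: le_trans (ler_wpM2l Ln0 h1).
  by rewrite mulrA ler_peMl.
have -> : hat V = hat W - p * hat U by rewrite WVU addrK.
rewrite (le_trans (ler_normB _ _))// normrM.
have h2 : `|p| * `|hat U| <= Mp * `|hat U| by rewrite ler_wpM2r.
apply: (le_trans (lerD hW h2)); rewrite le_eqVlt; apply/orP; left; apply/eqP; ring.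
Qed.

(** A rate [m] of the form [e / 2 * n + k] dominates the square root of an affine
    function of [n] once [k] is large; the other half of [e * n] absorbs the
    linear prefactor. *)
Lemma subexponential_rate (L M b H e : R) : 0 <= L -> 0 <= M -> 0 <= b -> 0 <= H ->
  0 < e -> exists C, forall n : nat, exists m, [/\ 0 < m,
    2 * (L * n.+1%:R + M) <= m ^+ 2 &
    2 * (L * n.+1%:R * b) * H * expR m <= C * expR (e * n%:R)].
Proof.
move=> L0 M0 b0 H0 e0.
pose k := 2 * L / e + 2 * (L + M) + 1.
have Le0 : 0 <= 2 * L / e by rewrite divr_ge0 ?mulr_ge0// ltW.
have k1 : 1 <= k by rewrite /k; lra.
have ek : 2 * L <= e * k.
  have -> : e * k = 2 * L + e * (2 * (L + M) + 1).
    by rewrite /k; field; rewrite gt_eqF.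
  by rewrite lerDl mulr_ge0 ?(ltW e0)//; lra.
have kk : 2 * (L + M) <= k ^+ 2.
  have : k <= k ^+ 2 by rewrite expr2 ler_peMl//; lra.
  by rewrite /k in k1 *; lra.
clearbody k.
exists (2 * L * b * H * expR k * (1 + 2 / e)) => n.
have n0 : 0 <= n%:R :> R by [].
exists (e / 2 * n%:R + k); split.
- by rewrite ltr_wpDl ?mulr_ge0 ?divr_ge0 ?(ltW e0)//; lra.
- have nek := ler_wpM2r n0 ek.
  have sq : 0 <= (e / 2 * n%:R) ^+ 2 by rewrite sqr_ge0.
  have -> : (e / 2 * n%:R + k) ^+ 2 = (e / 2 * n%:R) ^+ 2 + e * k * n%:R + k ^+ 2 by field.
  have -> : 2 * (L * n.+1%:R + M) = 2 * L * n%:R + 2 * (L + M) by rewrite -natr1; ring.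
  by rewrite (le_trans (lerD nek kk))// -addrA lerDr.
- have en0 : 0 <= e / 2 * n%:R by rewrite mulr_ge0// divr_ge0// ltW.
  have h : n.+1%:R <= (1 + 2 / e) * expR (e / 2 * n%:R).
    apply: (@le_trans _ _ ((1 + 2 / e) * (1 + e / 2 * n%:R))).
      have -> : (1 + 2 / e) * (1 + e / 2 * n%:R) = 1 + n%:R + 2 / e + e / 2 * n%:R.
        by field; rewrite gt_eqF.
      have : 0 <= 2 / e by rewrite divr_ge0// ltW.
      by move=> e2; rewrite -nat1r -addrA lerDl addr_ge0.
    by rewrite ler_wpM2l ?expR_ge1Dx// addr_ge0 ?divr_ge0 ?(ltW e0).
  have -> : e * n%:R = e / 2 * n%:R + e / 2 * n%:R by field.
  rewrite !expRD; set X := expR (e / 2 * n%:R) in h *.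
  have X0 : 0 <= X by exact: expR_ge0.
  have -> : 2 * (L * n.+1%:R * b) * H * (X * expR k) =
      (2 * L * b * H * expR k * X) * n.+1%:R by ring.
  have -> : 2 * L * b * H * expR k * (1 + 2 / e) * (X * X) =
      (2 * L * b * H * expR k * X) * ((1 + 2 / e) * X) by ring.
  by rewrite ler_wpM2l// !mulr_ge0 ?expR_ge0.
Qed.

Lemma L2cyl_integrable (T : R) (f : R -> R -> R) : L2cyl T f ->
  (mu \x mu)%E.-integrable (cyl T) (fun z => (f z.1 z.2)%:E).
Proof.
apply: (@L2_integrable _ _ R (mu \x mu)%E (cyl T) (fun z => f z.1 z.2)).
  by apply: measurableX; exact: measurable_itv.
have mI : measurable (`]0, 1[ : set (measurableTypeR R)) by exact: measurable_itv.
have mT : measurable (`]0, T[ : set (measurableTypeR R)) by exact: measurable_itv.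
have : (mu `]0%R, 1%R[ * mu `]0%R, T[ < +oo)%E.
  by apply: lte_mul_pinfty; rewrite ?ge0_fin_numE//; exact: lebesgue_oo_lty.
by rewrite -(@product_measure1E _ _ _ _ R mu mu _ _ mI mT).
Qed.

End sideways_estimate.

(** * Unique continuation *)

Unset Implicit Arguments.

Theorem proposition5 (R : realType) (T a : R) (p : R -> R)
    (u dtu ux uxx : R -> R -> R) (g : R -> R)
    (T_gt0 : 0 < T) (a_gt0 : 0 < a) (a_lt1 : a < 1)
    (p_cont : {within `[0, 1], continuous p})
    (p_le0 : forall x, x \in `[0, 1] -> p x <= 0)
    (u_H : H_L2 a T u)
    (u_L2H2 : L2H2 T u ux uxx)
    (u_dt : frac_deriv a T u dtu)
    (u_eq : (fun z : R * R => dtu z.1 z.2) =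
            (fun z => uxx z.1 z.2 + p z.1 * u z.1 z.2) %[ae leb2 in cyl T])
    (u_0 : \forall t \ae leb, t \in `]0, T[ -> has_trace (u^~ t) 0 0)
    (ux_0 : \forall t \ae leb, t \in `]0, T[ -> has_trace (ux^~ t) 0 0)
    (ux_1 : \forall t \ae leb, t \in `]0, T[ -> has_trace (ux^~ t) 1 (g t))
    (g_H : H_scalar a T g) :
  (fun z : R * R => u z.1 z.2) = (fun=> 0) %[ae leb2 in cyl T].
Proof.
pose mu := @lebesgue_measure R.
have [L2w Ju] := u_dt; have [L2u L2ux L2uxx wd] := u_L2H2.
(* The inverse of 0 is 0: if [Gamma a] vanishes then so do [J] and [u]. *)
have [G0|G0] := eqVneq (Gamma a) 0.
  by apply: ae_imp Ju => z Jz cz; rewrite -Jz// /J G0 invr0 mul0r.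
have mI : measurable (`]0, 1[ : set (measurableTypeR R)) by exact: measurable_itv.
have mT : measurable (`]0, T[ : set (measurableTypeR R)) by exact: measurable_itv.
have intu := L2cyl_integrable L2u; have intux := L2cyl_integrable L2ux.
have intuxx := L2cyl_integrable L2uxx; have intw := L2cyl_integrable L2w.
have [Mp pM] := within_continuous_bounded ler01 p_cont.
have Mp0 : 0 <= Mp by apply: le_trans (pM 0 _); rewrite // in_itv/= lexx ler01.
have mE n : measurable_fun (`]0, T[ : set R) (fun t : R => expR (n%:R * (T - t))).
  exact: measurable_expR_affine.
have EM (n : nat) (t : R) : t \in `]0, T[ -> `|expR (n%:R * (T - t))| <= expR (n%:R * T).
  exact: norm_expR_affine_le.
pose hat n (f : R -> R -> R) x := exp_moment T n (f x).
have int_hat n f : (mu \x mu)%E.-integrable (cyl T) (fun z => (f z.1 z.2)%:E) ->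
    mu.-integrable `]0, 1[ (EFin \o (hat n f)).
  move=> intf.
  exact: (rect_integrable_Rintegral mI mT (f := fun x t => expR (n%:R * (T - t)) * f x t)
    (@rect_integrable_mul2 _ _ _ _ R mu mu _ _ mI mT f _ _ intf (mE n) (EM n))).
have hat_u n : \forall x \ae mu, x \in `]0, 1[ ->
    hat n u x = \int[mu]_(y in `]0, x[) hat n ux y.
  apply: (weighted_primitive intu intux (mE n) (EM n)).
  apply: ae_imp2 wd u_0 => t wdt u0t tT.
  exact: weak_deriv_primitive (wdt tT).1 (u0t tT).
have hat_ux n : \forall x \ae mu, x \in `]0, 1[ ->
    hat n ux x = \int[mu]_(y in `]0, x[) hat n uxx y.
  apply: (weighted_primitive intux intuxx (mE n) (EM n)).
  apply: ae_imp2 wd ux_0 => t wdt ux0t tT.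
  exact: weak_deriv_primitive (wdt tT).2 (ux0t tT).
pose W x := \int[mu]_(t in `]0, T[) `|dtu x t|.
have intW : mu.-integrable `]0, 1[ (EFin \o W).
  exact: (rect_integrable_Rintegral mI mT (f := fun x t => `|dtu x t|)
    (@integrable_norm _ _ _ (mu \x mu)%E _ (fun z => dtu z.1 z.2) intw)).
have W0 (x : R) : x \in `]0, 1[ -> 0 <= W x by move=> _; exact: Rintegral_ge0.
pose L := inverse_symbol a T; have L0 : 0 < L by exact: inverse_symbol_gt0.
pose K := kernel_mass a T.
have K0 : 0 <= K.
  by rewrite mulr_ge0 ?invr_ge0 ?Gamma_ge0//; apply: Rintegral_ge0 => r _; exact: powR_ge0.
have slice n : \forall x \ae mu, x \in `]0, 1[ -> `|hat n uxx x| <=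
    (L * n.+1%:R + Mp) * `|hat n u x| + L * n.+1%:R * K * W x.
  have aeu := rect_ae_integrable mI mT (f := u) intu.
  have aeuxx := rect_ae_integrable mI mT (f := uxx) intuxx.
  have aew := rect_ae_integrable mI mT (f := dtu) intw.
  have aeJ := ae_prod_iterated Ju; have aeeq := ae_prod_iterated u_eq.
  have ae12 := ae_imp2 (fun _ => @conj _ _) aeu aeuxx.
  have ae34 := ae_imp2 (fun _ => @conj _ _) aew aeJ.
  have ae14 := ae_imp2 (fun _ => @conj _ _) ae12 ae34.
  apply: ae_imp2 ae14 aeeq => x [[iu iuxx] [iw jx]] eqx x01.
  have px : `|p x| <= Mp by apply: pM; exact: subset_itv_oo_cc.
  exact: (@slice_estimate R a T (p x) Mp (u x) (uxx x) (dtu x) n G0 T_gt0 a_lt1 px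
    (iu x01) (iuxx x01) (iw x01) (jx x01) (eqx x01)).
set H := \int[mu]_(x in `]0, 1[) W x.
have H0 : 0 <= H by exact: Rintegral_ge0.
have bound : \forall x \ae mu, forall n, x \in `]0, 1[ ->
    forall m, 0 < m -> 2 * (L * n.+1%:R + Mp) <= m ^+ 2 ->
    `|hat n u x| <= 2 * (L * n.+1%:R * K) * H * expR m.
  apply/ae_foralln => n.
  have A0 : 0 <= L * n.+1%:R + Mp by rewrite addr_ge0 ?mulr_ge0// ltW.
  have B0 : 0 <= L * n.+1%:R * K by rewrite mulr_ge0// mulr_ge0// ltW.
  exact: (double_primitive_gronwall (int_hat n _ intuxx) intW (int_hat n _ intux)
    W0 A0 B0 (hat_u n) (hat_ux n) (slice n)).
apply: (ae_iterated_prod_eq0 mI mT intu).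
have aeu := rect_ae_integrable mI mT (f := u) intu.
apply: ae_imp2 bound aeu => x bx iux x01.
apply: (exp_moments_eq0 T_gt0 (iux x01)) => e e0.
have [C HC] := subexponential_rate (ltW L0) Mp0 K0 H0 e0.
exists C => n; have [m [m0 mA mC]] := HC n.
exact: le_trans (bx n x01 m m0 mA) mC.
Qed.
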